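(* There exist universal constants $c_p>0$ and $\tilde c_0>0$ such that the following holds. Let $M=(\mathcal S,\mathcal A,P,r)$ be a weakly communicating MDP with finite state and action sets and rewards in $[0,1]$, let $H:=sp(h^* )$ be the span of the bias of a gain-optimal policy, with $H\ge1$, let $\delta\in(0,1]$ and $\varepsilon\in(0,1]$, and take $\gamma=1-\frac{\varepsilon}{12H}$. Let $\hat\pi$ be the policy output by the reduction algorithm described in the context, run with inputs $H,\varepsilon,\delta$, perturbation constant $c_p$, and $N$ independent samples from the generative model at each state-action pair. If \[ N\ge\tilde c_0\,H\,\varepsilon^{-3}\ln\Bigl(\frac{|\mathcal S||\mathcal A|}{\varepsilon\delta}\Bigr), \] then with probability at least $1-\delta$, $\rho^{\hat\pi}\ge\rho^*-\varepsilon$ (at every state).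
   Context: An MDP is a tuple $M=(\mathcal S,\mathcal A,P,r)$ with finite state set $\mathcal S$, finite action set $\mathcal A$, transition probabilities $P(s'\mid s,a)$ and reward $r:\mathcal S\times\mathcal A\to[0,1]$ (known and deterministic). A stationary policy $\pi$ assigns to each state $s$ a probability distribution $\pi(\cdot\mid s)$ on $\mathcal A$; it induces trajectories with $a_t\sim\pi(\cdot\mid s_t)$, $r_t=r(s_t,a_t)$, $s_{t+1}\sim P(\cdot\mid s_t,a_t)$. A generative model of $M$ returns, on each query $(s,a)$, an independent sample $s'\sim P(\cdot\mid s,a)$. Values: $V_\gamma^\pi(s):=\mathbb E^\pi[\sum_{t\ge0}\gamma^t r_t\mid s_0=s]$; an optimal policy of the discounted MDP $(M,\gamma)$ maximizes $V_\gamma^\pi$ at all states simultaneously. $V_T^\pi(s):=\mathbb E^\pi[\sum_{t=0}^{T-1}r_t\mid s_0=s]$; gain $\rho^\pi(s):=\lim_{T\to\infty}\frac1T V_T^\pi(s)$; bias $h^\pi(s):=\mathrm{C}\text{-}\lim_{T\to\infty}[V_T^\pi(s)-T\rho^\pi(s)]$ (Cesàro limit). The optimal gain is $\rho^*:=\max_\pi\rho^\pi$ (over all history-dependent policies). $M$ is weakly communicating if, apart from a (possibly empty) set of states that are transient in the Markov chain induced by every policy, for any two other states $s_1,s_2$ there is a policy to go from $s_1$ to $s_2$. In this case $\rho^*$ is a constant vector. The optimal bias is $h^*:=h^{\pi^*}$, where $\pi^*$ is a stationary gain-optimal policy, i.e. $\rho^{\pi^*}=\rho^*$; no further condition is placed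 on $\pi^*$ (the quantity $H=sp(h^* )$ is described as the span of the bias of any optimal policy). The span of a vector $x$ is $sp(x):=\max_i x_i-\min_i x_i$. Reduction algorithm. (1) Set $\gamma=1-\frac{\varepsilon}{12H}$ and $\varepsilon_\gamma=\frac{\varepsilon}{12(1-\gamma)}$. (2) Set $\xi=\frac{c_p(1-\gamma)\varepsilon_\gamma}{|\mathcal S|^5|\mathcal A|^5}$ and define the perturbed reward $r_p(s,a)=r(s,a)+\zeta(s,a)$ with $\zeta(s,a)$ i.i.d. uniform on $(0,\xi)$. (3) Draw $N$ samples from the generative model at each state-action pair and form the empirical MDP $\widehat M_p=(\mathcal S,\mathcal A,\widehat P,r_p)$, where $\widehat P(\cdot\mid s,a)$ is the empirical distribution of the $N$ samples drawn at $(s,a)$. (4) Solve the discounted MDP $(\widehat M_p,\gamma)$ with Q-value iteration, denote its optimal policy by $\hat\pi$, and output $\hat\pi$. The probability is over the samples and the perturbation. *)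

(* Defs.v *)
(* MathComp / MathComp-Analysis. *)
From HB Require Import structures.
From mathcomp Require Import all_boot all_order all_algebra.
From mathcomp Require Import all_classical all_reals all_analysis.

Set Implicit Arguments.
Unset Strict Implicit.
Unset Printing Implicit Defensive.

Import Order.TTheory GRing.Theory Num.Theory.
Import numFieldNormedType.Exports.
Local Open Scope classical_set_scope.
Local Open Scope ring_scope.

Definition is_dist (R : realType) (T : finType) (mu : T -> R) : Prop :=
  (forall x, 0 <= mu x) /\ \sum_x mu x = 1.

(* The raw data (P, r) only: the perturbed empirical model has the same shape
   but its rewards may exceed 1, so the constraints are in [is_mdp]. *)
Record mdp (R : realType) (S A : finType) := Mdp {
  trans : S -> A -> S -> R;
  reward : S -> A -> R }.

Definition is_mdp (R : realType) (S A : finType) (M : mdp R S A) : Prop :=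
  (forall s a, is_dist (trans M s a)) /\
  (forall s a, 0 <= reward M s a <= 1).

Definition policy (R : realType) (S A : finType) := S -> A -> R.

Definition is_policy (R : realType) (S A : finType) (pi : policy R S A) : Prop :=
  forall s, is_dist (pi s).

(* The first argument is the list of past state-action pairs, oldest first. *)
Definition hpolicy (R : realType) (S A : finType) := seq (S * A) -> S -> A -> R.

Definition is_hpolicy (R : realType) (S A : finType) (pi : hpolicy R S A) : Prop :=
  forall h s, is_dist (pi h s).

Definition stationary (R : realType) (S A : finType) (pi : policy R S A) :
  hpolicy R S A := fun _ => pi.

(* Probability that, after history [h] and with the current state distributed
   as [mu], the next [size tau] state-action pairs are exactly [tau]. *)
Fixpoint traj_prob (R : realType) (S A : finType) (M : mdp R S A)
    (pi : hpolicy R S A) (h : seq (S * A)) (mu : S -> R) (tau : seq (S * A)) : R :=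
  match tau with
  | [::] => 1
  | (s, a) :: tau' =>
      mu s * pi h s a * traj_prob M pi (rcons h (s, a)) (trans M s a) tau'
  end.

(* E^pi[ f((s_0,a_0),...,(s_{n-1},a_{n-1})) | s_0 = s ]. *)
Definition expect (R : realType) (S A : finType) (M : mdp R S A)
    (pi : hpolicy R S A) (s : S) (n : nat) (f : n.-tuple (S * A) -> R) : R :=
  \sum_(tau : n.-tuple (S * A))
    traj_prob M pi [::] (fun x => (x == s)%:R) tau * f tau.

Definition Vhor (R : realType) (S A : finType) (M : mdp R S A)
    (pi : hpolicy R S A) (T : nat) (s : S) : R :=
  expect M pi s (fun tau : T.-tuple (S * A) =>
    \sum_(t < T) reward M (tnth tau t).1 (tnth tau t).2).

(* E^pi[ sum_{t >= 0} gamma^t r_t | s_0 = s ], as the limit of the expectations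
   of the partial sums (for 0 <= gamma < 1 and bounded rewards). *)
Definition Vdisc (R : realType) (S A : finType) (M : mdp R S A) (gamma : R)
    (pi : policy R S A) (s : S) : R :=
  limn (fun n : nat =>
    expect M (stationary pi) s (fun tau : n.-tuple (S * A) =>
      \sum_(t < n) gamma ^+ t * reward M (tnth tau t).1 (tnth tau t).2)).

Definition disc_optimal (R : realType) (S A : finType) (M : mdp R S A)
    (gamma : R) (pi : policy R S A) : Prop :=
  is_policy pi /\
  forall pi', is_policy pi' -> forall s, Vdisc M gamma pi' s <= Vdisc M gamma pi s.

Definition gain (R : realType) (S A : finType) (M : mdp R S A)
    (pi : policy R S A) (s : S) : R :=
  limn (fun T : nat => Vhor M (stationary pi) T s / T%:R).

(* For a history-dependent policy V_T / T need not converge, hence the liminf;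
   on stationary policies it is the limit [gain]. *)
Definition opt_gain (R : realType) (S A : finType) (M : mdp R S A) (s : S) : R :=
  sup [set limn_inf (fun T : nat => Vhor M pi T s / T%:R) |
       pi in [set pi : hpolicy R S A | is_hpolicy pi]].

Definition gain_optimal (R : realType) (S A : finType) (M : mdp R S A)
    (pi : policy R S A) : Prop :=
  is_policy pi /\ forall s, gain M pi s = opt_gain M s.

Definition bias (R : realType) (S A : finType) (M : mdp R S A)
    (pi : policy R S A) (s : S) : R :=
  limn (arithmetic_mean (fun T : nat =>
    Vhor M (stationary pi) T s - T%:R * gain M pi s)).

(* On a finite nonempty type the sup and inf are attained: max x - min x. *)
Definition sp (R : realType) (S : finType) (x : S -> R) : R :=
  sup (range x) - inf (range x).

(* P^pi( s_t = s' for some 0 <= t <= n | s_0 = s ). *)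
Definition visit_prob (R : realType) (S A : finType) (M : mdp R S A)
    (pi : policy R S A) (s s' : S) (n : nat) : R :=
  expect M (stationary pi) s (fun tau : n.+1.-tuple (S * A) =>
    (s' \in unzip1 tau)%:R).

(* P^pi( s_t = s for some 1 <= t <= n | s_0 = s ). *)
Definition return_prob (R : realType) (S A : finType) (M : mdp R S A)
    (pi : policy R S A) (s : S) (n : nat) : R :=
  expect M (stationary pi) s (fun tau : n.+1.-tuple (S * A) =>
    (s \in behead (unzip1 tau))%:R).

Definition transient (R : realType) (S A : finType) (M : mdp R S A)
    (pi : policy R S A) (s : S) : Prop :=
  limn (return_prob M pi s) < 1.

Definition accessible (R : realType) (S A : finType) (M : mdp R S A)
    (pi : policy R S A) (s s' : S) : Prop :=
  exists n, 0 < visit_prob M pi s s' n.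

Definition weakly_communicating (R : realType) (S A : finType)
    (M : mdp R S A) : Prop :=
  exists U : {set S},
    (forall s, s \in U -> forall pi, is_policy pi -> transient M pi s) /\
    (forall s1 s2, s1 \notin U -> s2 \notin U ->
       exists pi, is_policy pi /\ accessible M pi s1 s2).

(* Mutual independence of a finite family of sigma-algebras. *)
Definition mutually_independent (R : realType) (d : measure_display)
    (Omega : measurableType d) (Pr : probability Omega R) (I : finType)
    (F : I -> set (set Omega)) : Prop :=
  forall (J : {set I}) (E : I -> set Omega),
    (forall i, i \in J -> F i (E i)) ->
    Pr (\bigcap_(i in [set i | i \in J]) E i) = (\prod_(i in J) Pr (E i))%E.

(* Sigma-algebras generated by the samples [X s a i] (discrete target) and by
   the perturbations [zeta s a] (Borel target). *)
Definition noise_sigma (R : realType) (S A : finType) (N : nat)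
    (d : measure_display) (Omega : measurableType d)
    (X : S -> A -> 'I_N -> Omega -> S) (zeta : S -> A -> Omega -> R)
    (i : (S * A * 'I_N) + (S * A)) : set (set Omega) :=
  match i with
  | inl (s, a, k) => preimage_set_system setT (X s a k) setT
  | inr (s, a) => preimage_set_system setT (zeta s a) measurable
  end.

Record algorithm_noise (R : realType) (S A : finType) (M : mdp R S A) (N : nat)
    (xi : R) (d : measure_display) (Omega : measurableType d)
    (Pr : probability Omega R)
    (X : S -> A -> 'I_N -> Omega -> S) (zeta : S -> A -> Omega -> R) : Prop := {
  samples_measurable : forall s a k s', measurable (X s a k @^-1` [set s']);
  samples_law : forall s a k s',
    Pr (X s a k @^-1` [set s']) = (trans M s a s')%:E;
  zeta_measurable : forall s a, measurable_fun setT (zeta s a);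
  zeta_uniform : forall s a (B : set R), measurable B ->
    Pr (zeta s a @^-1` B) =
      (\int[lebesgue_measure]_(x in B) (uniform_pdf 0 xi x)%:E)%E;
  noise_independent : mutually_independent Pr (noise_sigma X zeta) }.

Definition red_gamma (R : realType) (H eps : R) : R := 1 - eps / (12 * H).

Definition red_eps (R : realType) (H eps : R) : R :=
  eps / (12 * (1 - red_gamma H eps)).

Definition red_xi (R : realType) (S A : finType) (cp H eps : R) : R :=
  cp * (1 - red_gamma H eps) * red_eps H eps / (#|S|%:R ^+ 5 * #|A|%:R ^+ 5).

Definition perturbed_empirical (R : realType) (S A : finType) (M : mdp R S A)
    (N : nat) (x : S -> A -> 'I_N -> S) (z : S -> A -> R) : mdp R S A :=
  Mdp (fun s a s' => #|[pred k | x s a k == s']|%:R / N%:R)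
      (fun s a => reward M s a + z s a).

(* [pihat w] is a policy the algorithm may output when its random draws are
   those of the outcome [w]: any optimal policy of the discounted model. *)
Definition reduction_output (R : realType) (S A : finType) (M : mdp R S A)
    (H eps : R) (N : nat) (Omega : Type)
    (X : S -> A -> 'I_N -> Omega -> S) (zeta : S -> A -> Omega -> R)
    (pihat : Omega -> policy R S A) : Prop :=
  forall w,
    disc_optimal
      (perturbed_empirical M (fun s a k => X s a k w) (fun s a => zeta s a w))
      (red_gamma H eps) (pihat w).

(* Main.v *)
Require Import Defs.
From HB Require Import structures.
From mathcomp Require Import all_boot all_order all_algebra.
From mathcomp Require Import all_classical all_reals all_analysis.
From mathcomp Require Import ring lra.

Set Implicit Arguments.
Unset Strict Implicit.
Unset Printing Implicit Defensive.

Import Order.TTheory GRing.Theory Num.Theory.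
Import numFieldNormedType.Exports.
Local Open Scope classical_set_scope.
Local Open Scope ring_scope.

(* Let [V] be the optimal discounted value of the perturbed empirical model and
   [L = 1 / (1 - gamma)].

   Concentration. Bernstein's inequality is used with a fixed parameter [l], as
   [Phat f <= P f + l * Var_P f + b] with probability [1 - exp (- N l b)]. It
   applies to [V] although [V] depends on the samples: with everything but the
   row [(s, a)] fixed, the own value at [(s, a)] is a monotone statistic of the
   row, so that all violating rows violate the bound for one and the same fixed
   function. No net over values is needed, hence no [ln H] in the sample size.
   The perturbation is first rounded to a fine grid, which makes the randomness
   finite with a product law.

   Lower bound on [V]. With [h >= 0] the shifted bias of the gain-optimal policy,
   the fixed potential [h + 9 * l * h ^ 2] is almost subharmonic for the empirical
   chain: its quadratic part yields a multiple of [Var_P h] that absorbs the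
   deviation, and costs only O(l H). Hence
   [(1 - gamma) * V >= rho - O(eps)].

   Gain. In the same way [V + 2 * l * V ^ 2] shows that under the true chain of
   the output policy the gain is at least [(1 - gamma) * min V - O(eps)]; here
   [V <= 2 L] and [l * L] is of order [eps], which is what
   [N >= c0 * H * eps ^- 3 * ln (..)] allows.

   The optimal gain [rho] is constant because it is superharmonic for every
   action, so that its set of minimisers is closed under all actions. *)

(** * Finite distributions and stochastic kernels *)

Definition mean (R : realType) (S : finType) (p f : S -> R) : R :=
  \sum_s p s * f s.

Definition dvariance (R : realType) (S : finType) (p f : S -> R) : R :=
  mean p (fun s => (f s - mean p f) ^+ 2).

Definition kop (R : realType) (S : finType) (K : S -> S -> R) (f : S -> R) :
  S -> R := fun s => mean (K s) f.

Lemma eq_mean (R : realType) (S : finType) (p f g : S -> R) :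
  f =1 g -> mean p f = mean p g.
Proof. by move=> fg; apply: eq_bigr => s _; rewrite fg. Qed.

Lemma meanD (R : realType) (S : finType) (p f g : S -> R) :
  mean p (fun s => f s + g s) = mean p f + mean p g.
Proof. by rewrite /mean -big_split; apply: eq_bigr => s _; rewrite mulrDr. Qed.

Lemma meanZ (R : realType) (S : finType) (p f : S -> R) (c : R) :
  mean p (fun s => c * f s) = c * mean p f.
Proof.
by rewrite /mean mulr_sumr; apply: eq_bigr => s _; rewrite mulrCA.
Qed.

Lemma meanN (R : realType) (S : finType) (p f : S -> R) :
  mean p (fun s => - f s) = - mean p f.
Proof. by rewrite /mean -sumrN; apply: eq_bigr => s _; rewrite mulrN. Qed.

Lemma meanB (R : realType) (S : finType) (p f g : S -> R) :
  mean p (fun s => f s - g s) = mean p f - mean p g.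
Proof. by rewrite meanD meanN. Qed.

Lemma mean_cst (R : realType) (S : finType) (p : S -> R) (c : R) :
  is_dist p -> mean p (fun=> c) = c.
Proof. by case=> _ p1; rewrite /mean -mulr_suml p1 mul1r. Qed.

Lemma ler_mean (R : realType) (S : finType) (p f g : S -> R) :
  is_dist p -> (forall s, f s <= g s) -> mean p f <= mean p g.
Proof. by case=> p0 _ fg; apply: ler_sum => s _; apply: ler_wpM2l. Qed.

Lemma mean_le_cst (R : realType) (S : finType) (p f : S -> R) (c : R) :
  is_dist p -> (forall s, f s <= c) -> mean p f <= c.
Proof. by move=> pd fc; have := ler_mean pd fc; rewrite mean_cst. Qed.

Lemma mean_ge_cst (R : realType) (S : finType) (p f : S -> R) (c : R) :
  is_dist p -> (forall s, c <= f s) -> c <= mean p f.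
Proof. by move=> pd fc; have := ler_mean pd fc; rewrite mean_cst. Qed.

Lemma mean_affine (R : realType) (S : finType) (p f : S -> R) (a c : R) :
  is_dist p -> mean p (fun s => a * f s + c) = a * mean p f + c.
Proof. by move=> pd; rewrite meanD meanZ mean_cst. Qed.

Lemma dvariance_mean (R : realType) (S : finType) (p f : S -> R) :
  is_dist p -> dvariance p f = mean p (fun s => f s ^+ 2) - mean p f ^+ 2.
Proof.
move=> pd; rewrite /dvariance; set m := mean p f.
rewrite (@eq_mean _ _ p _ (fun s => f s ^+ 2 + (- (2 * m) * f s + m ^+ 2))); last first.
  by move=> s; ring.
by rewrite meanD mean_affine// -/m; ring.
Qed.

Lemma dvariance_ge0 (R : realType) (S : finType) (p f : S -> R) :
  is_dist p -> 0 <= dvariance p f.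
Proof. by move=> pd; apply: mean_ge_cst => // s; rewrite sqr_ge0. Qed.

Lemma dvarianceN (R : realType) (S : finType) (p f : S -> R) :
  dvariance p (fun s => - f s) = dvariance p f.
Proof.
by apply: eq_mean => s; rewrite meanN -opprD sqrrN.
Qed.

Lemma dvariance_le_center (R : realType) (S : finType) (p f : S -> R) (c : R) :
  is_dist p -> dvariance p f <= mean p (fun s => (f s - c) ^+ 2).
Proof.
move=> pd; rewrite dvariance_mean//; set m := mean p f.
rewrite (@eq_mean _ _ p (fun s => (f s - c) ^+ 2)
  (fun s => f s ^+ 2 + (- (2 * c) * f s + c ^+ 2))); last by move=> s; ring.
rewrite meanD mean_affine// -/m -subr_ge0.
suff -> : mean p (fun s => f s ^+ 2) + (- (2 * c) * m + c ^+ 2) -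
  (mean p (fun s => f s ^+ 2) - m ^+ 2) = (m - c) ^+ 2 by exact: sqr_ge0.
by ring.
Qed.

(** At a maximiser [m] of [D] the hypothesis gives [D m <= g * D m], which excludes a positive value
    since [g < 1]. Comparisons of discounted values below rest on it. *)
Lemma maximum_principle (R : realType) (S : finType) (K : S -> S -> R) (g : R)
    (D : S -> R) :
  (forall s, is_dist (K s)) -> 0 <= g < 1 ->
  (forall s, D s <= g * kop K D s) -> forall s, D s <= 0.
Proof.
move=> Kd /andP[g0 g1] Dle s; pose m := [arg max_(i > s) D i]%O.
have Dm t : D t <= D m by rewrite /m; case: arg_maxP => // i _ /(_ t); apply.
apply: (le_trans (Dm s)).
have : D m <= g * D m.
  by apply: le_trans (Dle m) _; apply: ler_wpM2l => //; apply: mean_le_cst.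
nra.
Qed.

Lemma kop_iter_bounded (R : realType) (S : finType) (K : S -> S -> R)
    (f : S -> R) (c : R) n :
  (forall s, is_dist (K s)) -> (forall s, `|f s| <= c) ->
  forall s, `|iter n (kop K) f s| <= c.
Proof.
move=> Kd fc; elim: n => [//|n IH] s /=; rewrite ler_norml.
by apply/andP; split; [apply: mean_ge_cst|apply: mean_le_cst] => // t;
  move: (IH t); rewrite ler_norml => /andP[].
Qed.

Lemma bounded_finType (R : realType) (S : finType) (f : S -> R) :
  exists c, forall s, `|f s| <= c.
Proof.
exists (\sum_s `|f s|) => s; rewrite (bigD1 s)//= lerDl.
by apply: sumr_ge0 => t _; exact: normr_ge0.
Qed.

(** * The Poisson equation of a finite Markov chain *)

Lemma kop_iter_poisson (R : realType) (S : finType) (K : S -> S -> R)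
    (r k y : S -> R) n :
  (forall s, is_dist (K s)) -> (forall s, kop K k s = k s) ->
  (forall s, r s = k s + y s - kop K y s) ->
  forall s, iter n (fun J t => r t + kop K J t) (fun=> 0) s =
            n%:R * k s + y s - iter n (kop K) y s.
Proof.
move=> Kd Kk ry; elim: n => [|n IH] s /=; first by rewrite mul0r add0r subrr.
rewrite ry /kop (eq_mean (K s) IH) meanB meanD meanZ -!/(kop _ _ _) Kk -natr1; ring.
Qed.

Lemma archimedean_small (R : realType) (a c : R) :
  (forall n, n%:R * a <= c) -> a <= 0.
Proof.
move=> H; rewrite leNgt; apply/negP => a0.
have := H (Num.truncn (c / a)).+1; apply/negP; rewrite -ltNge.
by rewrite -ltr_pdivrMr// truncnS_gt.
Qed.

(** Iterating the relation yields [n * k = y - K^n y], whose right side is bounded uniformly in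
    [n]. *)
Lemma harmonic_coboundary0 (R : realType) (S : finType) (K : S -> S -> R)
    (k y : S -> R) :
  (forall s, is_dist (K s)) -> (forall s, kop K k s = k s) ->
  (forall s, k s = y s - kop K y s) -> forall s, k s = 0.
Proof.
move=> Kd Kk ky s; have [c yc] := bounded_finType y.
have yE n t : n%:R * k t = y t - iter n (kop K) y t.
  elim: n t => [|n IH] t /=; first by rewrite mul0r subrr.
  rewrite (_ : kop K _ t = kop K (fun u => y u - n%:R * k u) t); last first.
    by apply: eq_mean => u; rewrite IH; ring.
  rewrite /kop meanB meanZ -!/(kop _ _ _) Kk -natr1 mulrDl mul1r {2}ky; ring.
have kc n : `|n%:R * k s| <= 2 * c.
  rewrite yE; apply: le_trans (ler_normB _ _) _.
  by have := kop_iter_bounded n Kd yc s; have := yc s; lra.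
apply/eqP; rewrite -normr_le0; apply: (@archimedean_small _ _ (2 * c)) => n.
by rewrite -(ger0_norm (ler0n R n)) -normrM.
Qed.

(* The kernel and the image of [1 - K] meet trivially because powers of [K] are
   bounded, so they span the whole space. *)
Lemma poisson_decomposition (R : realType) (S : finType) (K : S -> S -> R)
    (r : S -> R) :
  (forall s, is_dist (K s)) ->
  exists k y, (forall s, kop K k s = k s) /\
              (forall s, r s = k s + y s - kop K y s).
Proof.
move=> Kd; pose n := #|S|.
pose v (f : S -> R) : 'rV[R]_n := \row_j f (enum_val j).
pose w (u : 'rV[R]_n) (s : S) : R := u 0 (enum_rank s).
(* Functions are row vectors here, so [B] is the transpose of [K] and right multiplication by [B]
   acts as [kop K]. *)
pose B : 'M[R]_n := \matrix_(i, j) K (enum_val j) (enum_val i).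
pose C := 1%:M - B.
have wv f : w (v f) = f by apply/funext => s; rewrite /w mxE enum_rankK.
have vw u : v (w u) = u by apply/rowP => j; rewrite mxE /w enum_valK.
have wB u s : w (u *m B) s = kop K (w u) s.
  rewrite /w mxE /kop /mean.
  rewrite [RHS](reindex_onto enum_val enum_rank) /=; last first.
    by move=> i _; rewrite enum_rankK.
  by apply: eq_big => [i|i _]; rewrite ?enum_valK ?eqxx// !mxE enum_rankK mulrC.
have wC u s : w (u *m C) s = w u s - kop K (w u) s.
  by rewrite -wB mulmxBr mulmx1 /w !mxE.
have dis : (kermx C :&: C)%MS = 0.
  apply/eqP/rowV0P => x; rewrite sub_capmx => /andP[/sub_kermxP xC /submxP[y xy]].
  have x0 : w x = (fun=> 0).
    apply/funext; apply: (@harmonic_coboundary0 _ _ K _ (w y)) => // s.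
      by have := wC x s; rewrite xC /w mxE => /eqP; rewrite eq_sym subr_eq0 => /eqP.
    by rewrite xy wC.
  by rewrite -(vw x) x0; apply/rowP => j; rewrite !mxE.
have full : row_full (kermx C + C)%MS.
  by rewrite /row_full mxrank_disjoint_sum// mxrank_ker subnK ?rank_leq_row.
have /sub_addsmxP[[a b] /= vr] := submx_full (v r) full.
exists (w (a *m kermx C)), (w b); split=> s.
  have := wC (a *m kermx C) s; rewrite -mulmxA mulmx_ker mulmx0 /w mxE.
  by move/eqP; rewrite eq_sym subr_eq0 => /eqP.
by rewrite -addrA -wC -[in LHS](wv r) vr /w mxE.
Qed.

(** * Expectations over trajectories *)

Lemma sum_tupleS (V : nmodType) (T : finType) n (F : seq T -> V) :
  \sum_(t : n.+1.-tuple T) F t = \sum_x \sum_(t : n.-tuple T) F (x :: t).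
Proof.
rewrite pair_bigA /=.
rewrite (reindex (fun p : T * n.-tuple T => cons_tuple p.1 p.2)) //=.
exists (fun t : n.+1.-tuple T => (thead t, behead_tuple t)) => [[x t] _|t _] /=.
  by congr (_, _); apply: val_inj.
by apply: val_inj => /=; rewrite [in RHS](tuple_eta t).
Qed.

(* [expect] with an arbitrary past and initial distribution, so that the first
   step can be split off. *)
Definition traj_sum (R : realType) (S A : finType) (M : mdp R S A)
    (pi : hpolicy R S A) (h : seq (S * A)) (mu : S -> R) (n : nat)
    (F : seq (S * A) -> R) : R :=
  \sum_(tau : n.-tuple (S * A)) traj_prob M pi h mu tau * F tau.

Definition dirac_at (R : realType) (S : finType) (s : S) : S -> R :=
  fun x => (x == s)%:R.

Lemma dirac_at_dist (R : realType) (S : finType) (s : S) :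
  is_dist (dirac_at R s).
Proof.
split=> [x|]; first exact: ler0n.
rewrite (bigD1 s)//= /dirac_at eqxx big1 ?addr0// => i /negbTE -> //.
Qed.

Lemma mean_dirac (R : realType) (S : finType) (s : S) (f : S -> R) :
  mean (dirac_at R s) f = f s.
Proof.
rewrite /mean (bigD1 s)//= /dirac_at eqxx mul1r big1 ?addr0// => i /negbTE ->.
by rewrite mul0r.
Qed.

Lemma traj_sum0 (R : realType) (S A : finType) (M : mdp R S A)
    (pi : hpolicy R S A) h (mu : S -> R) F :
  traj_sum M pi h mu 0 F = F [::].
Proof.
rewrite /traj_sum (bigD1 [tuple])//= big1 ?addr0 ?mul1r// => t.
by case/negP; apply/eqP; exact: tuple0.
Qed.

Lemma traj_sumS (R : realType) (S A : finType) (M : mdp R S A)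
    (pi : hpolicy R S A) h (mu : S -> R) n F :
  traj_sum M pi h mu n.+1 F =
  mean mu (fun s => mean (pi h s) (fun a =>
    traj_sum M pi (rcons h (s, a)) (trans M s a) n (fun t => F ((s, a) :: t)))).
Proof.
rewrite /traj_sum (sum_tupleS n (fun t => traj_prob M pi h mu t * F t)).
rewrite (eq_bigr (fun x => \sum_(t : n.-tuple (S * A))
    traj_prob M pi h mu ((x.1, x.2) :: t) * F ((x.1, x.2) :: t))); last by case.
rewrite -(pair_bigA _ (fun s a => \sum_(t : n.-tuple (S * A))
    traj_prob M pi h mu ((s, a) :: t) * F ((s, a) :: t))) /=.
apply: eq_bigr => s _; rewrite mulr_sumr; apply: eq_bigr => a _ /=.
by rewrite mulrA mulr_sumr; apply: eq_bigr => t _; rewrite mulrA.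
Qed.

Lemma eq_traj_sum (R : realType) (S A : finType) (M : mdp R S A)
    (pi : hpolicy R S A) h (mu : S -> R) n F G :
  F =1 G -> traj_sum M pi h mu n F = traj_sum M pi h mu n G.
Proof. by move=> FG; apply: eq_bigr => t _; rewrite FG. Qed.

(** With [c = 0] this says that trajectory probabilities add up to 1; the general form splits the
    first reward off a discounted sum. *)
Lemma traj_sum_affine (R : realType) (S A : finType) (M : mdp R S A)
    (pi : hpolicy R S A) h (mu : S -> R) n F (b c : R) :
  (forall s a, is_dist (trans M s a)) -> is_hpolicy pi -> is_dist mu ->
  traj_sum M pi h mu n (fun t => b + c * F t) = b + c * traj_sum M pi h mu n F.
Proof.
move=> Pd pid; elim: n h mu F => [|n IH] h mu F mud.
  by rewrite !traj_sum0.
rewrite !traj_sumS.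
rewrite (@eq_mean _ _ _ _ (fun s => b + c * mean (pi h s) (fun a =>
    traj_sum M pi (rcons h (s, a)) (trans M s a) n (fun t => F ((s, a) :: t))))).
  by rewrite meanD meanZ mean_cst.
move=> s; rewrite (@eq_mean _ _ _ _ (fun a => b + c *
    traj_sum M pi (rcons h (s, a)) (trans M s a) n (fun t => F ((s, a) :: t)))).
  by rewrite meanD meanZ mean_cst.
by move=> a; rewrite IH.
Qed.

Lemma traj_sum_mean (R : realType) (S A : finType) (M : mdp R S A)
    (pi : hpolicy R S A) h (mu : S -> R) n F :
  is_dist mu ->
  traj_sum M pi h mu n F = mean mu (fun s => traj_sum M pi h (dirac_at R s) n F).
Proof.
move=> mud; case: n => [|n].
  by rewrite traj_sum0 (@eq_mean _ _ _ _ (fun=> F [::])) ?mean_cst// => s; rewrite traj_sum0.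
by rewrite traj_sumS; apply: eq_mean => s; rewrite traj_sumS mean_dirac.
Qed.

(** Only the behaviour on continuations of the two pasts matters. Hence a stationary policy forgets
    its past, and a policy that deviates at the first step only becomes stationary afterwards. *)
Lemma eq_traj_sum_policy (R : realType) (S A : finType) (M : mdp R S A)
    (pi pi' : hpolicy R S A) h h' (mu : S -> R) n F :
  (forall l, pi (h ++ l) = pi' (h' ++ l)) ->
  traj_sum M pi h mu n F = traj_sum M pi' h' mu n F.
Proof.
elim: n h h' mu F => [|n IH] h h' mu F E; first by rewrite !traj_sum0.
rewrite !traj_sumS; apply: eq_mean => s.
have := E [::]; rewrite !cats0 => ->; apply: eq_mean => a.
by apply: IH => l; rewrite -!cats1 -!catA.
Qed.

Definition pol_kernel (R : realType) (S A : finType) (M : mdp R S A)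
  (pi : policy R S A) (s s' : S) : R := mean (pi s) (fun a => trans M s a s').

Definition pol_reward (R : realType) (S A : finType) (M : mdp R S A)
  (pi : policy R S A) (s : S) : R := mean (pi s) (reward M s).

Lemma kop_pol_kernel (R : realType) (S A : finType) (M : mdp R S A)
    (pi : policy R S A) (f : S -> R) s :
  kop (pol_kernel M pi) f s = mean (pi s) (fun a => mean (trans M s a) f).
Proof.
rewrite /kop /mean /pol_kernel; under eq_bigr do rewrite /mean mulr_suml.
rewrite exchange_big; apply: eq_bigr => a _; rewrite mulr_sumr.
by apply: eq_bigr => t _; rewrite mulrA.
Qed.

Lemma pol_kernel_dist (R : realType) (S A : finType) (M : mdp R S A)
    (pi : policy R S A) :
  (forall s a, is_dist (trans M s a)) -> is_policy pi ->
  forall s, is_dist (pol_kernel M pi s).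
Proof.
move=> Pd pid s; split=> [t|].
  by apply: mean_ge_cst => // a; have [] := Pd s a.
have := kop_pol_kernel M pi (fun=> 1) s.
rewrite {1}/kop {1}/mean; under eq_bigr do rewrite mulr1.
by move=> ->; rewrite (@eq_mean _ _ _ _ (fun=> 1)) ?mean_cst// => a; rewrite mean_cst.
Qed.

Definition traj_exp (R : realType) (S A : finType) (M : mdp R S A)
    (pi : policy R S A) (n : nat) (F : seq (S * A) -> R) (s : S) : R :=
  traj_sum M (stationary pi) [::] (dirac_at R s) n F.

Lemma traj_expS (R : realType) (S A : finType) (M : mdp R S A)
    (pi : policy R S A) (n : nat) (F : seq (S * A) -> R) (s : S) :
  (forall s a, is_dist (trans M s a)) ->
  traj_exp M pi n.+1 F s =
  mean (pi s) (fun a => mean (trans M s a)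
    (traj_exp M pi n (fun t => F ((s, a) :: t)))).
Proof.
move=> Pd; rewrite /traj_exp traj_sumS mean_dirac; apply: eq_mean => a.
rewrite traj_sum_mean//; apply: eq_mean => s'.
by apply: eq_traj_sum_policy.
Qed.

(** Horner form of the discounted sum; its recursion follows the first-step splitting of
    [traj_sumS]. *)
Fixpoint seq_reward (R : realType) (S A : finType) (M : mdp R S A) (g : R)
    (t : seq (S * A)) : R :=
  if t is x :: t' then reward M x.1 x.2 + g * seq_reward M g t' else 0.

Lemma seq_rewardE (R : realType) (S A : finType) (M : mdp R S A) (g : R) n
    (t : n.-tuple (S * A)) :
  \sum_(i < n) g ^+ i * reward M (tnth t i).1 (tnth t i).2 = seq_reward M g t.
Proof.
elim: n t => [|n IH] t; first by rewrite big_ord0 tuple0.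
case/tupleP: t => x t; rewrite big_ord_recl /= expr0 mul1r -IH; congr (_ + _).
rewrite mulr_sumr; apply: eq_bigr => i _; rewrite exprS mulrA.
by rewrite !(tnth_nth x).
Qed.

Definition bellman_iter (R : realType) (S A : finType) (M : mdp R S A)
    (pi : policy R S A) (g : R) (n : nat) : S -> R :=
  iter n (fun J s => pol_reward M pi s + g * kop (pol_kernel M pi) J s) (fun=> 0).

Lemma traj_exp_reward (R : realType) (S A : finType) (M : mdp R S A)
    (pi : policy R S A) (g : R) n s :
  (forall s a, is_dist (trans M s a)) -> is_policy pi ->
  traj_exp M pi n (seq_reward M g) s = bellman_iter M pi g n s.
Proof.
Proof.
move=> Pd pid; elim: n s => [|n IH] s; first by rewrite /traj_exp traj_sum0.
rewrite traj_expS// /= /pol_reward kop_pol_kernel -meanZ -meanD.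
apply: eq_mean => a; rewrite /traj_exp.
under (@eq_mean _ _ _ (fun s' => traj_sum _ _ _ _ _ _)) => s'.
  rewrite traj_sum_affine//; last exact: dirac_at_dist.
  rewrite -/(traj_exp _ _ _ _ _) IH.
  over.
by rewrite meanD meanZ mean_cst.
Qed.

(** * Gain and bias *)

Lemma cvg_average (R : realType) (v : nat -> R) (k c : R) :
  (forall n, `|v n - n%:R * k| <= c) -> v n / n%:R @[n --> \oo] --> k.
Proof.
move=> vk; rewrite -cvg_shiftS /=.
have ch (b : R) : k + b * harmonic n @[n --> \oo] --> k.
  rewrite -[X in _ --> X]addr0 -[X in _ --> _ + X](mulr0 b).
  by apply: cvgD; [exact: cvg_cst|apply: cvgMr; exact: cvg_harmonic].
apply: (squeeze_cvgr _ (ch (- c)) (ch c)); apply: nearW => n /=.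
have n0 : 0 < n.+1%:R :> R by rewrite ltr0n.
have := vk n.+1; rewrite ler_norml => /andP[lo hi].
rewrite ler_pdivlMr// ler_pdivrMr// !mulrDl -!mulrA !mulVf ?gt_eqF// !mulr1.
by rewrite [k * _]mulrC; apply/andP; split; lra.
Qed.

Lemma Vhor_traj_sum (R : realType) (S A : finType) (M : mdp R S A)
    (pi : hpolicy R S A) n s :
  Vhor M pi n s = traj_sum M pi [::] (dirac_at R s) n (seq_reward M 1).
Proof.
apply: eq_bigr => t _; rewrite -(seq_rewardE M 1 t); congr (_ * _).
by apply: eq_bigr => i _; rewrite expr1n mul1r.
Qed.

Lemma Vhor_stationary (R : realType) (S A : finType) (M : mdp R S A)
    (pi : policy R S A) n s :
  (forall s a, is_dist (trans M s a)) -> is_policy pi ->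
  Vhor M (stationary pi) n s = bellman_iter M pi 1 n s.
Proof. by move=> Pd pid; rewrite Vhor_traj_sum -traj_exp_reward. Qed.

(** Used to find the Cesàro limit of [K^n y] in the definition of the bias. *)
Lemma kop_iter_telescope (R : realType) (S : finType) (K : S -> S -> R)
    (r k y : S -> R) n :
  (forall s, is_dist (K s)) -> (forall s, kop K k s = k s) ->
  (forall s, r s = k s + y s - kop K y s) ->
  forall s, \sum_(0 <= i < n) iter i (kop K) r s =
            n%:R * k s + y s - iter n (kop K) y s.
Proof.
move=> Kd Kk ry s.
have iE i : forall t, iter i (kop K) r t =
    k t + iter i (kop K) y t - iter i.+1 (kop K) y t.
  elim: i => [|i IH] t /=; first exact: ry.
  by rewrite {1}/kop (eq_mean _ IH) meanB meanD -!/(kop _ _ _) Kk.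
elim: n => [|n IH]; first by rewrite big_nil mul0r add0r subrr.
by rewrite big_nat_recr//= IH iE -natr1 /=; ring.
Qed.

Lemma Vhor_poisson (R : realType) (S A : finType) (M : mdp R S A)
    (pi : policy R S A) (k y : S -> R) n :
  (forall s a, is_dist (trans M s a)) -> is_policy pi ->
  (forall s, kop (pol_kernel M pi) k s = k s) ->
  (forall s, pol_reward M pi s = k s + y s - kop (pol_kernel M pi) y s) ->
  forall s, Vhor M (stationary pi) n s =
            n%:R * k s + y s - iter n (kop (pol_kernel M pi)) y s.
Proof.
move=> Pd pid Kk ry s; rewrite Vhor_stationary// /bellman_iter.
rewrite -(kop_iter_poisson n (pol_kernel_dist Pd pid) Kk ry).
by congr (iter _ _ _ _); apply/funext => J; apply/funext => t; rewrite mul1r.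
Qed.

Lemma Vhor_cvg (R : realType) (S A : finType) (M : mdp R S A)
    (pi : policy R S A) (k y : S -> R) :
  (forall s a, is_dist (trans M s a)) -> is_policy pi ->
  (forall s, kop (pol_kernel M pi) k s = k s) ->
  (forall s, pol_reward M pi s = k s + y s - kop (pol_kernel M pi) y s) ->
  forall s, Vhor M (stationary pi) n s / n%:R @[n --> \oo] --> k s.
Proof.
move=> Pd pid Kk ry s; have [c yc] := bounded_finType y.
apply: (@cvg_average _ _ _ (2 * c)) => n; rewrite (Vhor_poisson n Pd pid Kk ry).
rewrite (_ : _ - _ = y s - iter n (kop (pol_kernel M pi)) y s); last by ring.
apply: le_trans (ler_normB _ _) _.
by have := kop_iter_bounded n (pol_kernel_dist Pd pid) yc s; have := yc s; lra.
Qed.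

(** Write the reward as [k + y - K y] with [k] harmonic. The [n]-step value is then
    [n * k + y - K^n y], so the gain is [k]. The bias differs from [y] by a harmonic function only,
    which leaves the equation intact. *)
Lemma gain_bias_poisson (R : realType) (S A : finType) (M : mdp R S A)
    (pi : policy R S A) :
  (forall s a, is_dist (trans M s a)) -> is_policy pi ->
  (forall s, kop (pol_kernel M pi) (gain M pi) s = gain M pi s) /\
  (forall s, pol_reward M pi s =
    gain M pi s + bias M pi s - kop (pol_kernel M pi) (bias M pi) s).
Proof.
move=> Pd pid; have Kd := pol_kernel_dist Pd pid.
have [k [y [Kk ry]]] := poisson_decomposition (pol_reward M pi) Kd.
have gk : gain M pi = k.
  by apply/funext => s; apply/cvg_lim => //; exact: Vhor_cvg ry _.
(* Decomposing [y] in turn identifies the Cesàro limit of [K^n y] as [k'], its harmonic part. *)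
have [k' [y' [Kk' yy']]] := poisson_decomposition y Kd.
have bE : bias M pi = fun s => y s - k' s.
  apply/funext => s; apply/cvg_lim => //.
  have [c y'c] := bounded_finType y'.
  pose v n := \sum_(0 <= i < n) (Vhor M (stationary pi) i s - i%:R * gain M pi s).
  have := @cvg_average _ v (y s - k' s) (2 * c).
  rewrite -cvg_shiftS /= => vcvg.
  rewrite /arithmetic_mean /series /=.
  under eq_fun do rewrite mulrC.
  apply: vcvg => n; rewrite /v gk.
  rewrite (eq_bigr (fun i => y s - iter i (kop (pol_kernel M pi)) y s)); last first.
    by move=> i _; rewrite (Vhor_poisson i Pd pid Kk ry); ring.
  rewrite sumrB (kop_iter_telescope n Kd Kk' yy') sumr_const_nat subn0 -mulr_natl.
  rewrite (_ : _ - _ = iter n (kop (pol_kernel M pi)) y' s - y' s); last by ring.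
  apply: le_trans (ler_normB _ _) _.
  by have := kop_iter_bounded n Kd y'c s; have := y'c s; lra.
rewrite gk bE; split=> // s.
rewrite ry /kop meanB -!/(kop _ _ _) Kk'; ring.
Qed.

(** Subtracting the inequality for [f] from the Poisson equation and iterating gives
    [n * c <= n * gain + y - K^n y] with [y = bias - f]; the last two terms stay bounded. *)
Lemma gain_ge (R : realType) (S A : finType) (M : mdp R S A)
    (pi : policy R S A) (c : R) (f : S -> R) :
  (forall s a, is_dist (trans M s a)) -> is_policy pi ->
  (forall s, c + f s <= pol_reward M pi s + kop (pol_kernel M pi) f s) ->
  forall s, c <= gain M pi s.
Proof.
move=> Pd pid cf s; have Kd := pol_kernel_dist Pd pid.
have [Kk rh] := gain_bias_poisson Pd pid.
pose y s := bias M pi s - f s.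
have cy t : c <= gain M pi t + y t - kop (pol_kernel M pi) y t.
  have -> : kop (pol_kernel M pi) y t = kop (pol_kernel M pi) (bias M pi) t -
    kop (pol_kernel M pi) f t by exact: meanB.
  by have := cf t; rewrite rh /y; lra.
have [b yb] := bounded_finType y.
have Ty n : forall t, n%:R * c <=
    n%:R * gain M pi t + y t - iter n (kop (pol_kernel M pi)) y t.
  elim: n => [|n IH] t /=; first by rewrite !mul0r add0r subrr.
  have := mean_ge_cst (Kd t) (fun u => IH u); rewrite meanB meanD meanZ.
  rewrite -!/(kop _ _ _) Kk -natr1 !mulrDl !mul1r; have := cy t; lra.
rewrite -subr_le0; apply: (@archimedean_small _ _ (2 * b)) => n.
have := Ty n s; have := kop_iter_bounded n Kd yb s; have := yb s.
rewrite !ler_norml mulrBr; lra.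
Qed.

(** * The optimal gain is constant *)

Lemma traj_prob_ge0 (R : realType) (S A : finType) (M : mdp R S A)
    (pi : hpolicy R S A) h (mu : S -> R) t :
  (forall s a, is_dist (trans M s a)) -> is_hpolicy pi -> is_dist mu ->
  0 <= traj_prob M pi h mu t.
Proof.
move=> Pd pid; elim: t h mu => [//|[s a] t IH] h mu [mu0 _] /=.
by rewrite mulr_ge0 ?mulr_ge0 ?IH//; have [] := pid h s.
Qed.

Lemma seq_reward_bounds (R : realType) (S A : finType) (M : mdp R S A) t :
  is_mdp M -> 0 <= seq_reward M 1 t <= (size t)%:R.
Proof.
move=> [_ r01]; elim: t => [|x t IH] /=; first by rewrite lexx.
by have := r01 x.1 x.2; rewrite -natr1; lra.
Qed.

Lemma Vhor_bounds (R : realType) (S A : finType) (M : mdp R S A)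
    (pi : hpolicy R S A) n s :
  is_mdp M -> is_hpolicy pi -> 0 <= Vhor M pi n s <= n%:R.
Proof.
move=> Mm pid; have [Pd _] := Mm; rewrite Vhor_traj_sum.
have td t := traj_prob_ge0 [::] t Pd pid (dirac_at_dist R s).
apply/andP; split.
  apply: sumr_ge0 => t _; rewrite mulr_ge0//.
  by have /andP[] := seq_reward_bounds t Mm.
have := traj_sum_affine [::] n (fun=> 0) n%:R 0 Pd pid (dirac_at_dist R s).
rewrite !mul0r !addr0 => <-; apply: ler_sum => t _; rewrite ler_wpM2l//.
by have /andP[_] := seq_reward_bounds t Mm; rewrite size_tuple.
Qed.

Lemma limn_inf_le_opt_gain (R : realType) (S A : finType) (M : mdp R S A)
    (pi : hpolicy R S A) s :
  is_mdp M -> is_hpolicy pi ->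
  limn_inf (fun T : nat => Vhor M pi T s / T%:R) <= opt_gain M s.
Proof.
move=> Mm pid; apply: ub_le_sup; last by exists pi.
exists 1 => _ [pi' /= pi'd <-].
have uB n : 0 <= Vhor M pi' n s / n%:R <= 1.
  have /andP[V0 Vn] := Vhor_bounds n s Mm pi'd.
  (* At horizon 0 the average is 0, because division by 0 yields 0. *)
  rewrite divr_ge0//=; case: n V0 Vn => [|n] V0 Vn.
    by rewrite invr0 mulr0.
  by rewrite ler_pdivrMr ?mul1r.
rewrite limn_infE; last first.
  exists 1; split; first exact: num_real.
  move=> x x1 n _ /=; have /andP[u0 u1] := uB n.
  by rewrite ger0_norm// (le_trans u1)// ltW.
apply: ge_sup; first by exists (infs (fun T => Vhor M pi' T s / T%:R) 0%N), 0%N.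
move=> _ [n _ <-]; have /andP[_ u1] := uB n; apply: le_trans u1.
apply: ge_inf; last by exists n => /=.
by exists 0 => _ [m _ <-]; have /andP[] := uB m.
Qed.

Definition deviate_once (R : realType) (S A : finType) (a : A)
    (pi : policy R S A) : hpolicy R S A :=
  fun h s => if h is [::] then dirac_at R a else pi s.

(** Playing [a] once and [pi] afterwards is an admissible history-dependent policy. The first reward
    vanishes in the average, so its average reward from [s] tends to the left-hand side. *)
Lemma opt_gain_superharmonic (R : realType) (S A : finType) (M : mdp R S A)
    (pi : policy R S A) s a :
  is_mdp M -> gain_optimal M pi -> mean (trans M s a) (opt_gain M) <= opt_gain M s.
Proof.
move=> Mm [pid gpi]; have [Pd r01] := Mm.
have Kd := pol_kernel_dist Pd pid.
have [Kk rh] := gain_bias_poisson Pd pid.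
have dd : is_hpolicy (deviate_once a pi).
  by move=> [|? ?] t //=; exact: dirac_at_dist.
rewrite (eq_mean _ (fun t => esym (gpi t))).
apply: le_trans (limn_inf_le_opt_gain s Mm dd).
suff /cvg_limn_inf_sup[-> //] : Vhor M (deviate_once a pi) n s / n%:R
    @[n --> \oo] --> mean (trans M s a) (gain M pi).
have [c hc] := bounded_finType (bias M pi).
(* [2 * c] bounds the two bias terms, the absolute value accounts for [pi] being followed for one
   step less than the horizon, and 1 bounds the deviating reward. *)
apply: (@cvg_average _ _ _ (2 * c + `|mean (trans M s a) (gain M pi)| + 1)) => -[|n].
  rewrite Vhor_traj_sum traj_sum0 mul0r subrr normr0.
  have := hc s; have := normr_ge0 (bias M pi s).
  have := normr_ge0 (mean (trans M s a) (gain M pi)); lra.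
rewrite Vhor_traj_sum traj_sumS !mean_dirac /=.
rewrite traj_sum_affine// traj_sum_mean// mul1r.
rewrite (@eq_mean _ _ _ _ (Vhor M (stationary pi) n)); last first.
  move=> t; rewrite Vhor_traj_sum; exact: eq_traj_sum_policy.
rewrite (eq_mean _ (Vhor_poisson n Pd pid Kk rh)) meanB meanD meanZ.
set m := mean _ (gain _ _).
set y := mean _ (bias _ _); set z := mean _ (iter _ _ _).
have yc : `|y| <= c.
  rewrite ler_norml mean_ge_cst ?mean_le_cst// => t; have := hc t;
  by rewrite ler_norml => /andP[].
have zc : `|z| <= c.
  rewrite ler_norml mean_ge_cst ?mean_le_cst// => t;
  by have := kop_iter_bounded n Kd hc t; rewrite ler_norml => /andP[].
have := r01 s a; have := ler_norm m; have := ler_norm (- m); rewrite normrN.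
move: yc zc; rewrite !ler_norml -natr1; lra.
Qed.

Lemma cvg_mean (R : realType) (S : finType) (p : S -> R) (f : nat -> S -> R)
    (l : S -> R) :
  (forall s, f n s @[n --> \oo] --> l s) -> mean p (f n) @[n --> \oo] --> mean p l.
Proof.
move=> fl; rewrite /mean; apply: (@cvg_big _ _ _ _ _ _ _ _ _ (fun s n => p s * f n s)).
  exact: add_continuous.
by move=> s _; apply: cvgMr; exact: fl.
Qed.

(** * Hitting probabilities and recurrence *)

Definition hit_prob (R : realType) (S A : finType) (M : mdp R S A)
    (pi : policy R S A) (t : S) (n : nat) : S -> R :=
  traj_exp M pi n (fun tau => (t \in unzip1 tau)%:R).

Lemma hit_probS (R : realType) (S A : finType) (M : mdp R S A)
    (pi : policy R S A) (t : S) n s :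
  (forall s a, is_dist (trans M s a)) -> is_policy pi ->
  hit_prob M pi t n.+1 s =
  if s == t then 1 else kop (pol_kernel M pi) (hit_prob M pi t n) s.
Proof.
move=> Pd pid; rewrite /hit_prob traj_expS// kop_pol_kernel.
have [->|st] := eqVneq s t.
  rewrite (@eq_mean _ _ _ _ (fun=> 1)) ?mean_cst// => a.
  rewrite (@eq_mean _ _ _ _ (fun=> 1)) ?mean_cst// => s'.
  rewrite -[RHS](addr0 1) -[in RHS](mul0r (traj_exp M pi n (fun=> 0) s')).
  rewrite /traj_exp -traj_sum_affine//; last exact: dirac_at_dist.
  by apply: eq_traj_sum => l; rewrite inE eqxx mul0r addr0.
apply: eq_mean => a; apply: eq_mean => s'; apply: eq_traj_sum => l.
by rewrite inE eq_sym (negbTE st).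
Qed.

Lemma return_prob_hit (R : realType) (S A : finType) (M : mdp R S A)
    (pi : policy R S A) (t : S) n :
  (forall s a, is_dist (trans M s a)) ->
  return_prob M pi t n = kop (pol_kernel M pi) (hit_prob M pi t n) t.
Proof.
move=> Pd; rewrite kop_pol_kernel.
exact: (@traj_expS _ _ _ M pi n (fun tau => (t \in behead (unzip1 tau))%:R)).
Qed.

Lemma hit_prob_bounds (R : realType) (S A : finType) (M : mdp R S A)
    (pi : policy R S A) (t : S) n s :
  (forall s a, is_dist (trans M s a)) -> is_policy pi ->
  0 <= hit_prob M pi t n s <= 1.
Proof.
move=> Pd pid; elim: n s => [|n IH] s.
  by rewrite /hit_prob /traj_exp traj_sum0 in_nil lexx ler01.
rewrite hit_probS//; case: ifP => _; first by rewrite ler01 lexx.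
by rewrite mean_ge_cst ?mean_le_cst//; (try exact: pol_kernel_dist) => u;
  have /andP[] := IH u.
Qed.

Lemma hit_prob_nondecreasing (R : realType) (S A : finType) (M : mdp R S A)
    (pi : policy R S A) (t : S) s :
  (forall s a, is_dist (trans M s a)) -> is_policy pi ->
  nondecreasing_seq (fun n => hit_prob M pi t n s).
Proof.
move=> Pd pid; apply/nondecreasing_seqP => n; elim: n s => [|n IH] s.
  rewrite {1}/hit_prob /traj_exp traj_sum0 in_nil.
  by have /andP[] := hit_prob_bounds t 1 s Pd pid.
rewrite !(hit_probS _ _ _ Pd pid); case: ifP => // _.
by apply: ler_mean => //; exact: pol_kernel_dist.
Qed.

Lemma hit_prob_cvg (R : realType) (S A : finType) (M : mdp R S A)
    (pi : policy R S A) (t : S) s :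
  (forall s a, is_dist (trans M s a)) -> is_policy pi ->
  cvgn (fun n => hit_prob M pi t n s).
Proof.
move=> Pd pid; apply: nondecreasing_is_cvgn; first exact: hit_prob_nondecreasing.
by exists 1 => _ [n _ <-]; have /andP[] := hit_prob_bounds t n s Pd pid.
Qed.

Lemma hit_prob_closed (R : realType) (S A : finType) (M : mdp R S A)
    (pi : policy R S A) (C : pred S) (t : S) n :
  (forall s a, is_dist (trans M s a)) -> is_policy pi ->
  (forall x y, C x -> ~~ C y -> pol_kernel M pi x y = 0) ->
  ~~ C t -> forall s, C s -> hit_prob M pi t n s = 0.
Proof.
move=> Pd pid Cc Ct; elim: n => [|n IH] s Cs.
  by rewrite /hit_prob /traj_exp traj_sum0 in_nil.
rewrite hit_probS//; have [st|_] := eqVneq s t; first by rewrite -st Cs in Ct.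
apply: big1 => u _; have [Cu|Cu] := boolP (C u); first by rewrite IH// mulr0.
by rewrite Cc// mul0r.
Qed.

(* Otherwise the hitting probabilities [g s] of the states [s] of [C], weighted
   by the inverse escape probabilities, add up to a bounded [G] that loses at
   least 1 in expectation per step inside [C]. *)
Lemma closed_set_not_transient (R : realType) (S A : finType) (M : mdp R S A)
    (pi : policy R S A) (C : pred S) (x : S) :
  (forall s a, is_dist (trans M s a)) -> is_policy pi ->
  (forall x y, C x -> ~~ C y -> pol_kernel M pi x y = 0) ->
  C x -> exists2 s, C s & ~ transient M pi s.
Proof.
move=> Pd pid Cc Cx; apply: contrapT => noS.
have tr s : C s -> transient M pi s.
  by move=> Cs; apply: contrapT => ns; apply: noS; exists s.
have Kd := pol_kernel_dist Pd pid.
pose K := pol_kernel M pi.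
pose g t s := limn (fun n => hit_prob M pi t n s).
have gc t s : hit_prob M pi t n s @[n --> \oo] --> g t s by exact: hit_prob_cvg.
have g0 t s : 0 <= g t s.
  apply: limr_ge; first exact: hit_prob_cvg.
  by apply: nearW => n; have /andP[] := hit_prob_bounds t n s Pd pid.
have Kg t s : kop K (hit_prob M pi t n) s @[n --> \oo] --> kop K (g t) s.
  exact: cvg_mean.
have gE t s : g t s = if s == t then 1 else kop K (g t) s.
  rewrite /g; apply/cvg_lim => //; rewrite -cvg_shiftS /=.
  under eq_fun do rewrite hit_probS//.
  case: ifP => [_|_]; last exact: Kg.
  exact: cvg_cst.
have f1 t : C t -> kop K (g t) t < 1.
  move=> /tr; rewrite /transient (_ : return_prob M pi t = fun n =>
    kop K (hit_prob M pi t n) t); last by apply/funext => n; exact: return_prob_hit.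
  by rewrite (cvg_lim _ (Kg t t)).
pose w t := (1 - kop K (g t) t)^-1.
have w0 t : C t -> 0 < w t by move=> Ct; rewrite invr_gt0 subr_gt0 f1.
pose G s := \sum_(t | C t) w t * g t s.
have KG s : kop K G s = \sum_(t | C t) w t * kop K (g t) s.
  rewrite /kop /mean /G; under eq_bigr do rewrite mulr_sumr.
  rewrite exchange_big; apply: eq_bigr => t _; rewrite mulr_sumr.
  by apply: eq_bigr => u _; rewrite mulrCA.
have Gd s : C s -> G s = 1 + kop K G s.
  move=> Cs; rewrite KG /G (bigD1 s)//= [in RHS](bigD1 s)//= addrA.
  congr (_ + _).
    rewrite gE eqxx mulr1 /w; have := f1 s Cs; rewrite -subr_gt0 => /lt0r_neq0 n0.
    by field.
  by apply: eq_bigr => t /andP[_ ts]; rewrite gE eq_sym (negbTE ts).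
have Gn n : forall s, C s -> n%:R <= G s.
  elim: n => [|n IH] s Cs.
    by apply: sumr_ge0 => t Ct; rewrite mulr_ge0// ltW// w0.
  rewrite Gd// -natr1 addrC lerD2l -(mean_cst n%:R (Kd s)).
  apply: ler_sum => u _; have [Cu|Cu] := boolP (C u).
    by rewrite ler_wpM2l ?IH//; have [] := Kd s.
  by rewrite /K Cc// !mul0r.
suff : (1 : R) <= 0 by rewrite ler10.
by apply: (@archimedean_small _ _ (G x)) => n; rewrite mulr1; exact: Gn.
Qed.

(** The nonnegative terms [p t * (f t - c)] sum to at most 0, so each of them vanishes. *)
Lemma mean_attains_min (R : realType) (S : finType) (p f : S -> R) (c : R) :
  is_dist p -> (forall s, c <= f s) -> mean p f <= c ->
  forall s, f s != c -> p s = 0.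
Proof.
move=> pd cf fc s fs.
have h0 t : true -> 0 <= p t * (f t - c) by rewrite mulr_ge0 ?subr_ge0//; case: pd.
have : \sum_t p t * (f t - c) = 0.
  apply/eqP; rewrite eq_le sumr_ge0// andbT -/(mean p (fun t => f t - c)).
  by rewrite meanB mean_cst// subr_le0.
move=> /(psumr_eq0P h0)/(_ s isT)/eqP; rewrite mulf_eq0 subr_eq0 (negbTE fs) orbF.
by move/eqP.
Qed.

Lemma visit_prob_hit (R : realType) (S A : finType) (M : mdp R S A)
    (pi : policy R S A) (s t : S) n :
  visit_prob M pi s t n = hit_prob M pi t n.+1 s.
Proof. by []. Qed.

(** The minimisers are closed under every policy, the maximisers under [pi], for which the gain is
    harmonic. Both sets contain a state that is not transient under [pi], hence outside [U]. Some
    policy leads from the first such state to the second, yet it cannot leave the minimisers, so the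
    two extreme values agree. *)
Lemma opt_gain_constant (R : realType) (S A : finType) (M : mdp R S A)
    (pi : policy R S A) :
  is_mdp M -> weakly_communicating M -> gain_optimal M pi ->
  forall s t, opt_gain M s = opt_gain M t.
Proof.
move=> Mm [U [Utr Uacc]] gpi; have [Pd _] := Mm; have [pid gE] := gpi.
have ksup s a : mean (trans M s a) (opt_gain M) <= opt_gain M s.
  exact: opt_gain_superharmonic gpi.
have kK s : kop (pol_kernel M pi) (opt_gain M) s = opt_gain M s.
  by have [Kk _] := gain_bias_poisson Pd pid; have := Kk s; rewrite (funext gE).
move: (opt_gain M) ksup kK {gpi gE} => k ksup kK.
suff kmm s t : k s <= k t by move=> s t; apply/eqP; rewrite eq_le !kmm.
pose lo := [arg min_(i < s) k i]%O; pose hi := [arg max_(i > s) k i]%O.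
have klo u : k lo <= k u by rewrite /lo; case: arg_minP => // i _ /(_ u); apply.
have khi u : k u <= k hi by rewrite /hi; case: arg_maxP => // i _ /(_ u); apply.
have cl_lo pi' : is_policy pi' -> forall x y, k x == k lo -> k y != k lo ->
    pol_kernel M pi' x y = 0.
  move=> pi'd x y /eqP kx ky; apply: big1 => a _.
  rewrite (@mean_attains_min _ _ (trans M x a) k (k lo)) ?mulr0//.
  by rewrite -kx.
have cl_hi x y : k x == k hi -> k y != k hi -> pol_kernel M pi x y = 0.
  move=> /eqP kx ky.
  apply: (@mean_attains_min _ _ _ (fun u => - k u) (- k hi)).
  - exact: pol_kernel_dist.
  - by move=> u; rewrite lerN2.
  - by rewrite meanN lerN2 -kx -kK.
  - by rewrite eqr_opp.
have [x xlo xU] : exists2 x, k x == k lo & x \notin U.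
  have [x xlo xt] := closed_set_not_transient Pd pid (cl_lo _ pid) (eqxx (k lo)).
  by exists x => //; apply/negP => /Utr/(_ pi pid).
have [y yhi yU] : exists2 y, k y == k hi & y \notin U.
  have [y yhi yt] := closed_set_not_transient Pd pid cl_hi (eqxx (k hi)).
  by exists y => //; apply/negP => /Utr/(_ pi pid).
have [pi' [pi'd [n]]] := Uacc x y xU yU.
have [ylo _|ylo] := boolP (k y == k lo).
  by apply: le_trans (khi s) _; rewrite -(eqP yhi) (eqP ylo).
have h0 := hit_prob_closed n.+1 Pd pi'd (cl_lo _ pi'd) ylo xlo.
by rewrite visit_prob_hit h0 ltxx.
Qed.

(** * Discounted values *)

Lemma monotone_iter_cvg (R : realType) (S : finType) (T : (S -> R) -> S -> R)
    (c : R) :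
  (forall J J', (forall s, J s <= J' s) -> forall s, T J s <= T J' s) ->
  (forall s, 0 <= T (fun=> 0) s) -> 0 <= c ->
  (forall J, (forall s, J s <= c) -> forall s, T J s <= c) ->
  forall s, [/\ nondecreasing_seq (fun n => iter n T (fun=> 0) s),
    cvgn (fun n => iter n T (fun=> 0) s) &
    0 <= limn (fun n => iter n T (fun=> 0) s) <= c].
Proof.
move=> Tm T0 c0 Tc s.
have nd u : nondecreasing_seq (fun n => iter n T (fun=> 0) u).
  by apply/nondecreasing_seqP => n; elim: n u => [|n IH] u /=; [exact: T0|exact: Tm].
have ub n : forall u, iter n T (fun=> 0) u <= c by elim: n => [//|n IH] /=; exact: Tc.
have cv : cvgn (fun n => iter n T (fun=> 0) s).
  by apply: nondecreasing_is_cvgn; [exact: nd|exists c => _ [n _ <-]].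
split=> //; apply/andP; split; last by apply: limr_le => //; exact: nearW.
by apply: limr_ge => //; apply: nearW => n; exact: (nd s 0%N n (leq0n n)).
Qed.

(** Value iteration from 0 is increasing and bounded by [c / (1 - g)], the fixed point of
    [b = c + g * b]. The first inequality passes to the limit; the second holds because every
    iterate lies below the greedy update of the limit. *)
Lemma bellman_solution (R : realType) (S A : finType) (M : mdp R S A)
    (g c : R) (a0 : A) :
  (forall s a, is_dist (trans M s a)) -> 0 <= g < 1 ->
  (forall s a, 0 <= reward M s a <= c) ->
  exists V : S -> R, [/\ forall s, 0 <= V s <= c / (1 - g),
    forall s a, reward M s a + g * mean (trans M s a) V <= V s &
    forall s, exists a, V s <= reward M s a + g * mean (trans M s a) V].
Proof.
move=> Pd /andP[g0 g1] rc.
pose Q J s a := reward M s a + g * mean (trans M s a) J.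
pose act J s := [arg max_(a > a0) Q J s a]%O.
pose T J s := Q J s (act J s).
have QT J s a : Q J s a <= T J s.
  by rewrite /T /act; case: arg_maxP => // i _ /(_ a); apply.
have Qm J J' : (forall s, J s <= J' s) -> forall s a, Q J s a <= Q J' s a.
  by move=> JJ' s a; rewrite lerD2l ler_wpM2l// ler_mean.
have Tm J J' : (forall s, J s <= J' s) -> forall s, T J s <= T J' s.
  by move=> /Qm JJ' s; apply: le_trans (JJ' s _) (QT _ _ _).
have Qc J b s a : (forall s, J s <= b) -> Q J s a <= c + g * b.
  by move=> Jb; rewrite lerD ?ler_wpM2l ?mean_le_cst//; have /andP[] := rc s a.
have T0 s : 0 <= T (fun=> 0) s.
  by rewrite /T /Q mean_cst// mulr0 addr0; have /andP[] := rc s (act (fun=> 0) s).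
pose b := c / (1 - g).
have bE : c + g * b = b by rewrite /b; field; rewrite subr_eq0 eq_sym lt_eqF.
have [s0|noS] := pickP (@predT S); last first.
  by exists (fun=> 0); split=> s; have := noS s.
have c0 : 0 <= c by have /andP[] := rc s0 a0; exact: le_trans.
have b0 : 0 <= b by rewrite divr_ge0// subr_ge0 ltW.
have Tc J : (forall s, J s <= b) -> forall s, T J s <= b.
  by move=> Jb s; rewrite -bE; exact: Qc.
pose V s := limn (fun n => iter n T (fun=> 0) s).
have main := monotone_iter_cvg Tm T0 b0 Tc.
have cV s : iter n T (fun=> 0) s @[n --> \oo] --> V s by have [] := main s.
have JV n s : iter n T (fun=> 0) s <= V s.
  by have [nd cv _] := main s; exact: nondecreasing_cvgn_le.
exists V; split=> s; first by have [] := main s.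
- move=> a; have cQ : Q (iter n T (fun=> 0)) s a @[n --> \oo] --> Q V s a.
    by apply: cvgD; [exact: cvg_cst|apply: cvgMr; exact: cvg_mean].
  rewrite -/(Q V s a) -(cvg_lim _ cQ)//.
  apply: limr_le; first by apply/cvg_ex; exists (Q V s a).
  by apply: nearW => n; exact: le_trans (QT _ _ _) (JV n.+1 s).
- exists (act V s); apply: limr_le; first by have [] := main s.
  apply: nearW => -[|n] /=; first exact: le_trans (T0 s) (Tm _ _ (JV 0%N) s).
  exact: (Tm _ _ (JV n) s).
Qed.

Lemma Vdisc_bellman (R : realType) (S A : finType) (M : mdp R S A)
    (pi : policy R S A) (g c : R) :
  (forall s a, is_dist (trans M s a)) -> is_policy pi -> 0 <= g < 1 ->
  (forall s a, 0 <= reward M s a <= c) ->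
  forall s, Vdisc M g pi s =
    pol_reward M pi s + g * kop (pol_kernel M pi) (Vdisc M g pi) s.
Proof.
move=> Pd pid /andP[g0 g1] rc s; have Kd := pol_kernel_dist Pd pid.
pose T J s := pol_reward M pi s + g * kop (pol_kernel M pi) J s.
have VE u : Vdisc M g pi u = limn (fun n => iter n T (fun=> 0) u).
  rewrite /Vdisc; congr (lim (_ @ \oo)); apply/funext => n.
  rewrite -[RHS]/(bellman_iter M pi g n u) -traj_exp_reward//.
  by apply: eq_bigr => t _; rewrite seq_rewardE.
have rp u : 0 <= pol_reward M pi u <= c.
  by rewrite mean_ge_cst ?mean_le_cst// => a; have /andP[] := rc u a.
have c0 : 0 <= c by have /andP[] := rp s; exact: le_trans.
have cv := @monotone_iter_cvg _ _ T (c / (1 - g)).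
have {}cv : forall u, iter n T (fun=> 0) u @[n --> \oo] --> Vdisc M g pi u.
  move=> u; rewrite VE; have [|t||J Jc t|//] := cv _ _ _ _ u.
  - by move=> J J' JJ' t; rewrite lerD2l ler_wpM2l// ler_mean.
  - by rewrite /T /kop mean_cst// mulr0 addr0; have /andP[] := rp t.
  - by rewrite divr_ge0// subr_ge0 ltW.
  - rewrite (_ : c / (1 - g) = c + g * (c / (1 - g))); last first.
      by field; rewrite subr_eq0 eq_sym lt_eqF.
    have /andP[_ rt] := rp t; apply: lerD => //.
    by apply: ler_wpM2l => //; apply: mean_le_cst.
have cT : T (iter n T (fun=> 0)) s @[n --> \oo] --> T (Vdisc M g pi) s.
  by apply: cvgD; [exact: cvg_cst|apply: cvgMr; exact: cvg_mean].
have cS : T (iter n T (fun=> 0)) s @[n --> \oo] --> Vdisc M g pi s.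
  by have := cv s; rewrite -cvg_shiftS.
by apply: (cvg_unique _ cS cT).
Qed.

Lemma pol_average_le (R : realType) (S A : finType) (M : mdp R S A)
    (pi : policy R S A) (g : R) (V : S -> R) :
  is_policy pi ->
  (forall s a, reward M s a + g * mean (trans M s a) V <= V s) ->
  forall s, pol_reward M pi s + g * kop (pol_kernel M pi) V s <= V s.
Proof.
move=> pid rV s; rewrite kop_pol_kernel -meanZ -meanD.
by apply: mean_le_cst => // a; exact: rV.
Qed.

(** The value [W] of [pi] under [r'] satisfies [V <= W <= V + m / (1 - g)]: the lower bound compares
    with the greedy policy of [V], the upper one uses that [V] is a supersolution for [r]. Inserting
    both into the equation of [W] costs [m + g * m / (1 - g) = m / (1 - g)]. *)
Lemma disc_optimal_near_bellman (R : realType) (S A : finType)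
    (P : S -> A -> S -> R) (r r' : S -> A -> R) (g c m : R) (V : S -> R)
    (pi : policy R S A) :
  (forall s a, is_dist (P s a)) -> 0 <= g < 1 ->
  (forall s a, 0 <= r' s a <= c) ->
  (forall s a, r s a <= r' s a <= r s a + m) ->
  (forall s a, r s a + g * mean (P s a) V <= V s) ->
  (forall s, exists a, V s <= r s a + g * mean (P s a) V) ->
  disc_optimal (Mdp P r') g pi ->
  forall s, V s <= pol_reward (Mdp P r) pi s + m / (1 - g) +
                   g * kop (pol_kernel (Mdp P r) pi) V s.
Proof.
move=> Pd g01 rc rr' Vsup /choice[act Vact] [pid opt] s.
have /andP[g0 g1] := g01.
pose M := Mdp P r; pose M' := Mdp P r'.
pose K := pol_kernel M pi.
have Kd : forall u, is_dist (K u) by exact: pol_kernel_dist.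
have rW := @Vdisc_bellman _ _ _ M' pi g c Pd pid g01 rc.
set W := Vdisc M' g pi in rW.
have rpi u : pol_reward M pi u <= pol_reward M' pi u <= pol_reward M pi u + m.
  rewrite ler_mean//=; last by move=> a; have /andP[] := rr' u a.
  rewrite -[leRHS](_ : mean (pi u) (fun a => r u a + m) = _).
    by rewrite ler_mean// => a; have /andP[] := rr' u a.
  by rewrite meanD mean_cst.
have VW u : V u <= W u.
  pose pi' : policy R S A := fun t => dirac_at R (act t).
  have pi'd : is_policy pi' by move=> t; exact: dirac_at_dist.
  apply: le_trans (opt pi' pi'd u).
  have rW' := @Vdisc_bellman _ _ _ M' pi' g c Pd pi'd g01 rc.
  rewrite -subr_le0; apply: (@maximum_principle _ _ (pol_kernel M' pi') g
    (fun t => V t - Vdisc M' g pi' t)) => //; first exact: pol_kernel_dist.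
  move=> t; rewrite rW' {2}/kop meanB -!/(kop _ _ _) mulrBr.
  rewrite /pol_reward !kop_pol_kernel !mean_dirac /=.
  have := Vact t; have /andP[] := rr' t (act t); lra.
have WV u : W u <= V u + m / (1 - g).
  rewrite -subr_le0; apply: (@maximum_principle _ _ K g
    (fun t => W t - (V t + m / (1 - g)))) => // t.
  rewrite /kop meanB meanD mean_cst// -!/(kop K _ _).
  have := @pol_average_le _ _ _ M pi g V pid Vsup t; rewrite -/K.
  have /andP[_] := rpi t; have := rW t; rewrite -[pol_kernel M' pi]/K.
  have : m / (1 - g) = m + g * (m / (1 - g)).
    by field; rewrite subr_eq0 eq_sym lt_eqF.
  by move=> E -> h1 h2; rewrite {1}E; lra.
apply: le_trans (VW s) _; rewrite rW -[pol_kernel M' pi]/K -/K.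
have /andP[_] := rpi s.
have : kop K W s <= kop K V s + m / (1 - g).
  by rewrite -[X in _ + X](mean_cst _ (Kd s)) -meanD ler_mean.
move/(ler_wpM2l g0).
have : m / (1 - g) = m + g * (m / (1 - g)).
  by field; rewrite subr_eq0 eq_sym lt_eqF.
by move=> E h1 h2; rewrite {1}E; lra.
Qed.

(** * Quadratic potentials *)

Lemma mean_quadratic (R : realType) (S : finType) (p f : S -> R) (l : R) :
  is_dist p -> mean p (fun s => f s + l * f s ^+ 2) =
    mean p f + l * (dvariance p f + mean p f ^+ 2).
Proof. by move=> pd; rewrite meanD meanZ dvariance_mean// subrK. Qed.

(** On [[0, H]] the map [u + l * u ^ 2] has Lipschitz constant at most 3, hence the factor 9. *)
Lemma dvariance_quadratic_le (R : realType) (S : finType) (p f : S -> R)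
    (l H : R) :
  is_dist p -> (forall s, 0 <= f s <= H) -> 0 <= l -> l * H <= 1 ->
  dvariance p (fun s => f s + l * f s ^+ 2) <= 9 * dvariance p f.
Proof.
move=> pd fH l0 lH; pose m := mean p f.
have m0 : 0 <= m by apply: mean_ge_cst => // s; have /andP[] := fH s.
have mH : m <= H by apply: mean_le_cst => // s; have /andP[] := fH s.
apply: le_trans (dvariance_le_center _ (m + l * m ^+ 2) pd) _.
rewrite /dvariance -meanZ -/m; apply: ler_mean => // s; have /andP[f0 fs] := fH s.
rewrite (_ : _ - _ = (1 + l * (f s + m)) * (f s - m)); last by ring.
rewrite exprMn; apply: ler_wpM2r; first exact: sqr_ge0.
have lf : 0 <= l * (f s + m) <= 2.
  apply/andP; split; first by rewrite mulr_ge0 ?addr_ge0.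
  have : l * (f s + m) <= l * (H + H) by rewrite ler_wpM2l// lerD.
  lra.
nra.
Qed.

Lemma quadratic_potential_bounds (R : realType) (S : finType) (f : S -> R)
    (l H : R) :
  (forall s, 0 <= f s <= H) -> 0 <= l -> l * H <= 1 ->
  forall s, 0 <= f s + l * f s ^+ 2 <= 2 * H.
Proof.
move=> fH l0 lH s; have /andP[f0 fs] := fH s.
rewrite addr_ge0 ?mulr_ge0 ?sqr_ge0//=.
have : l * f s <= 1 by apply: le_trans lH; rewrite ler_wpM2l.
by move/(ler_wpM2r f0); rewrite expr2 mulrA; lra.
Qed.

(* Adding the small multiple [9 * l * h ^ 2] to the bias turns the variance of
   [h] into a gain that absorbs the Bernstein deviation of the potential. *)
Lemma value_lower_bound (R : realType) (S A : finType) (M M' : mdp R S A)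
    (pi : policy R S A) (rho H g l b : R) (h V : S -> R) :
  (forall s a, is_dist (trans M s a)) -> (forall s a, is_dist (trans M' s a)) ->
  is_policy pi -> (forall s a, reward M s a <= 1) ->
  (forall s a, reward M s a <= reward M' s a) ->
  0 <= rho -> (forall s, 0 <= h s <= H) -> 0 <= g < 1 -> 0 <= l ->
  9 * l * H <= 1 ->
  (forall s, pol_reward M pi s = rho + h s - kop (pol_kernel M pi) h s) ->
  (let f s := h s + 9 * l * h s ^+ 2 in forall s a,
    mean (trans M s a) f - l * dvariance (trans M s a) f - b <=
      mean (trans M' s a) f) ->
  (forall s a, reward M' s a + g * mean (trans M' s a) V <= V s) ->
  forall s, rho - (18 * l * H + b) - 2 * (1 - g) * H <= (1 - g) * V s.
Proof.
move=> Pd Pd' pid r1 rr' rho0 hH g01 l0 lH rh; set f := (fun s => _) => /= conc Vsup.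
have /andP[g0 g1] := g01.
have Kd' := pol_kernel_dist Pd' pid.
pose K := pol_kernel M pi; pose K' := pol_kernel M' pi.
have rp1 s : pol_reward M pi s <= 1 by apply: mean_le_cst.
have l9 : 0 <= 9 * l by rewrite mulr_ge0.
have fH : forall s, 0 <= f s <= 2 * H by exact: quadratic_potential_bounds.
(* The deviation [l * Var f] is at most [9 * l * Var h], exactly what the quadratic part of [f]
   supplies. The remaining square of the mean is replaced by its tangent at [h s]. *)
have fa s a : mean (trans M s a) h + 9 * l * (h s ^+ 2 +
    2 * h s * (mean (trans M s a) h - h s)) - b <= mean (trans M' s a) f.
  apply: le_trans (conc s a).
  have := dvariance_quadratic_le (Pd s a) hH l9 lH; rewrite -/f => vf.
  rewrite {1}/f mean_quadratic//; have := ler_wpM2l l0 vf.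
  have : 0 <= (9 * l) * (mean (trans M s a) h - h s) ^+ 2 by rewrite mulr_ge0 ?sqr_ge0.
  lra.
have fpi s : rho + f s - pol_reward M pi s - (18 * l * H + b) <= kop K' f s.
  rewrite /K' kop_pol_kernel; have := ler_mean (pid s) (fa s).
  apply: le_trans; rewrite meanB mean_cst// meanD meanZ meanD mean_cst// meanZ.
  rewrite meanB mean_cst// -kop_pol_kernel -/K.
  have : kop K h s - h s = rho - pol_reward M pi s by rewrite rh -/K; ring.
  move=> dE; rewrite dE.
  have /andP[h0 hs] := hH s.
  have : - (2 * (9 * l) * H) <= (9 * l) * (2 * h s * (rho - pol_reward M pi s)).
    have d1 : -1 <= rho - pol_reward M pi s by have := rp1 s; lra.
    have : 9 * l * (2 * h s) * (-1) <= 9 * l * (2 * h s) * (rho - pol_reward M pi s).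
      by rewrite ler_wpM2l// mulr_ge0// mulr_ge0.
    have := ler_wpM2l l9 hs; lra.
  rewrite /f; have := rh s; rewrite -/K; lra.
pose e := 18 * l * H + b.
(* With this constant [f + C] is a discounted subsolution for [M']: putting [g * K' f] for [K' f]
   costs at most [(1 - g) * (2 * H)]. *)
pose C := (rho - e) / (1 - g) - 2 * H.
have gn0 : 1 - g != 0 by rewrite subr_eq0 eq_sym lt_eqF.
have CE : (1 - g) * C = rho - e - 2 * (1 - g) * H by rewrite /C; field.
have WV s : f s + C - V s <= 0.
  apply: (@maximum_principle _ _ K' g (fun s => f s + C - V s)) => // t.
  rewrite /kop meanB meanD mean_cst// -!/(kop K' _ _).
  have := pol_average_le pid Vsup t; rewrite -/K'.
  have : pol_reward M pi t <= pol_reward M' pi t by apply: ler_mean.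
  have f2 : kop K' f t <= 2 * H by apply: mean_le_cst => // u; have /andP[] := fH u.
  have := fpi t; rewrite -/e.
  have : (1 - g) * kop K' f t <= (1 - g) * (2 * H) by rewrite ler_wpM2l// subr_ge0 ltW.
  lra.
move=> s; rewrite -/e -CE ler_wpM2l//; first by rewrite subr_ge0 ltW.
by have := WV s; have /andP[] := fH s; lra.
Qed.

(* The potential [V + 2 * l * V ^ 2] plays the same role under [M]. *)
Lemma gain_lower_bound (R : realType) (S A : finType) (M M' : mdp R S A)
    (pi : policy R S A) (g0 B g l b t : R) (V : S -> R) :
  (forall s a, is_dist (trans M s a)) -> is_policy pi ->
  (forall s a, reward M s a <= 1) -> -1 <= g0 -> 0 <= g < 1 ->
  (forall s, 0 <= V s <= B) -> 0 <= l -> 4 * l * B <= 1 -> 0 <= b -> 0 <= t ->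
  (forall s, g0 <= (1 - g) * V s) ->
  (forall s, V s <= pol_reward M pi s + t + g * kop (pol_kernel M' pi) V s) ->
  (forall s a, mean (trans M' s a) V <=
     mean (trans M s a) V + l * dvariance (trans M s a) V + b) ->
  forall s, g0 - (8 * l * B + 2 * b + 2 * t) <= gain M pi s.
Proof.
move=> Pd pid r1 g0N /andP[gg0 gg1] VB l0 lB b0 t0 gV Vpi conc.
have Kd := pol_kernel_dist Pd pid; pose K := pol_kernel M pi.
pose Phi s := V s + 2 * l * V s ^+ 2.
apply: (@gain_ge _ _ _ _ _ _ Phi) => // s; rewrite -/K.
pose v := mean (pi s) (fun a => dvariance (trans M s a) V).
pose X := kop K V s; pose r := pol_reward M pi s.
have v0 : 0 <= v by apply: mean_ge_cst => // a; exact: dvariance_ge0.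
have r1s : r <= 1 by apply: mean_le_cst.
have /andP[V0 VsB] := VB s.
have lV0 : 0 <= l * V s by rewrite mulr_ge0.
have lVB : l * V s <= l * B by rewrite ler_wpM2l.
have X0 : 0 <= X by apply: mean_ge_cst => // u; have /andP[] := VB u.
have gX : g0 <= (1 - g) * X.
  by rewrite /X /kop -meanZ; apply: mean_ge_cst.
have XK : kop (pol_kernel M' pi) V s <= X + l * v + b.
  rewrite kop_pol_kernel /X /K kop_pol_kernel; have := ler_mean (pid s) (conc s).
  by rewrite !meanD meanZ mean_cst.
have VX : V s - (r - g0 + l * v + b + t) <= X.
  have lv0 : 0 <= l * v by rewrite mulr_ge0.
  have : g * kop (pol_kernel M' pi) V s <= g * X + (l * v + b).
    apply: le_trans (ler_wpM2l gg0 XK) _.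
    have : g * (l * v + b) <= 1 * (l * v + b).
      by apply: ler_wpM2r; [exact: addr_ge0|exact: ltW].
    lra.
  by have := Vpi s; rewrite -/r; lra.
have PhiK : X + 2 * l * (v + V s ^+ 2 + 2 * V s * (X - V s)) <= kop K Phi s.
  rewrite /K kop_pol_kernel (@eq_mean _ _ _ (fun a => mean _ Phi)
    (fun a => mean (trans M s a) V + 2 * l * (dvariance (trans M s a) V +
       mean (trans M s a) V ^+ 2))); last by move=> a; exact: mean_quadratic.
  rewrite meanD meanZ meanD -/v -kop_pol_kernel -/K -/X lerD2l.
  rewrite ler_wpM2l ?mulr_ge0// -addrA lerD2l.
  have := @ler_mean _ _ (pi s) (fun a => V s ^+ 2 + 2 * V s * (mean (trans M s a) V - V s))
     (fun a => mean (trans M s a) V ^+ 2) (pid s).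
  rewrite meanD mean_cst// meanZ meanB mean_cst// -kop_pol_kernel -/K -/X.
  apply => a; rewrite -subr_ge0.
  by rewrite (_ : _ - _ = (mean (trans M s a) V - V s) ^+ 2) ?sqr_ge0//; ring.
(* The factor is the coefficient of [X] in [PhiK]. It is at most 2, so the error [l * v] grows to at
   most [2 * l * v], which the variance term of [PhiK] cancels. *)
have key : (1 + 4 * l * V s) * (V s - (r - g0 + l * v + b + t)) <=
           (1 + 4 * l * V s) * X by rewrite ler_wpM2l//; lra.
(* Here [r <= 1] and [g0 >= -1]; this is the origin of the loss [8 * l * B]. *)
have p1 : 4 * (l * V s) * (r - g0) <= 4 * (l * V s) * 2.
  by rewrite ler_wpM2l; lra.
have p2 : (1 + 4 * (l * V s)) * (l * v + b + t) <= 2 * (l * v + b + t).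
  rewrite ler_wpM2r ?addr_ge0 ?mulr_ge0//; lra.
rewrite -/r /Phi; move: PhiK key p1 p2; rewrite /Phi; lra.
Qed.

(** * Concentration of the empirical value *)

(** Squaring [expR (- x / 2) >= 1 - x / 2] reduces the claim to a polynomial inequality, whose
    defect [x ^ 2 * (1 - 3 * x + x ^ 2) / 4] is nonnegative for [x <= 1 / 3]. *)
Lemma expR_le_quadratic (R : realType) (x : R) :
  x <= 1 / 3 -> expR x <= 1 + x + x ^+ 2.
Proof.
move=> x3; have e := expR_ge1Dx (- (x / 2)).
have y0 : 0 < 1 - x / 2 by lra.
have E : expR x * expR (- (x / 2)) ^+ 2 = 1.
  by rewrite -expRM_natl -expRD (_ : x + _ = 0) ?expR0//; field.
have h1 : expR x * (1 - x / 2) ^+ 2 <= 1.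
  rewrite -[leRHS]E ler_wpM2l ?expR_ge0// ler_pXn2r ?nnegrE ?expR_ge0//.
  exact: ltW.
have h2 : 1 <= (1 + x + x ^+ 2) * (1 - x / 2) ^+ 2.
  rewrite -subr_ge0 (_ : _ - 1 = x ^+ 2 * ((1 - 3 * x + x ^+ 2) / 4)); last by field.
  by rewrite mulr_ge0 ?sqr_ge0//; have := sqr_ge0 x; lra.
by rewrite -(ler_pM2r (exprn_gt0 2 y0)); exact: le_trans h2.
Qed.

Definition iid_prob (R : realType) (S : finType) (p : S -> R) N
  (x : {ffun 'I_N -> S}) : R := \prod_i p (x i).

Definition sample_mean (R : realType) (S : finType) N (x : 'I_N -> S)
  (f : S -> R) : R := (\sum_i f (x i)) / N%:R.

Lemma sum_iid_prob (R : realType) (S : finType) (p : S -> R) N :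
  is_dist p -> \sum_(x : {ffun 'I_N -> S}) iid_prob p x = 1.
Proof.
by case=> _ p1; rewrite -(bigA_distr_bigA (fun _ s => p s)) big1.
Qed.

Lemma iid_prob_ge0 (R : realType) (S : finType) (p : S -> R) N
    (x : {ffun 'I_N -> S}) : is_dist p -> 0 <= iid_prob p x.
Proof. by case=> p0 _; exact: prodr_ge0. Qed.

(* Chernoff's method with the fixed parameter [l]. *)
Lemma bernstein_linear (R : realType) (S : finType) (p f : S -> R) N (l b : R) :
  is_dist p -> (0 < N)%N -> 0 <= l ->
  (forall s, l * (f s - mean p f) <= 1 / 3) ->
  \sum_(x : {ffun 'I_N -> S} |
      mean p f + l * dvariance p f + b < sample_mean x f) iid_prob p x
    <= expR (- (N%:R * l * b)).
Proof.
move=> pd N0 l0 lf; set m := mean p f; set v := dvariance p f.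
have N0' : 0 < N%:R :> R by rewrite ltr0n.
pose c := l * (l * v + b).
(* On the violating event the product of the exponential factors is at least 1, so [w] dominates the
   probability; its sum factorises over the samples. *)
pose w (x : {ffun 'I_N -> S}) : R := \prod_i (p (x i) * expR (l * (f (x i) - m) - c)).
apply: (@le_trans _ _ (\sum_x w x)).
  rewrite big_mkcond; apply: ler_sum => x _.
  have w0 : 0 <= w x by apply: prodr_ge0 => i _; rewrite mulr_ge0 ?expR_ge0//; case: pd.
  case: ifP => // bad; rewrite /w big_split /= -expR_sum.
  rewrite -[leLHS]mulr1 ler_wpM2l ?iid_prob_ge0// -expR0 ler_expR.
  have -> : \sum_(i < N) (l * (f (x i) - m) - c) =
      l * (N%:R * sample_mean x f) - N%:R * (l * m + c).
    have -> : N%:R * sample_mean x f = \sum_i f (x i).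
      by rewrite mulrC divfK// gt_eqF.
    rewrite (eq_bigr (fun i => l * f (x i) + - (l * m + c))); last by move=> i _; ring.
    by rewrite big_split /= -mulr_sumr sumr_const card_ord -mulr_natl; ring.
  have -> : l * (N%:R * sample_mean x f) - N%:R * (l * m + c) =
      N%:R * (l * (sample_mean x f - (m + l * v + b))) by rewrite /c; ring.
  by rewrite mulr_ge0 ?mulr_ge0 ?subr_ge0// ltW.
rewrite -(bigA_distr_bigA (fun _ s => p s * expR (l * (f s - m) - c))) /=.
rewrite prodr_const card_ord.
have -> : expR (- (N%:R * l * b)) = expR (- (l * b)) ^+ N.
  by rewrite -expRM_natl; congr expR; ring.
have s0 : 0 <= \sum_j p j * expR (l * (f j - m) - c).
  by apply: sumr_ge0 => s _; rewrite mulr_ge0 ?expR_ge0//; case: pd.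
rewrite lerXn2r ?nnegrE ?expR_ge0//.
have le1 : mean p (fun s => expR (l * (f s - m))) <= expR (l ^+ 2 * v).
  apply: le_trans (expR_ge1Dx _).
  apply: le_trans (ler_mean pd (fun s => expR_le_quadratic (lf s))) _.
  rewrite -/m; under (@eq_mean _ _ p) do rewrite exprMn.
  by rewrite meanD meanD meanZ meanZ meanB !mean_cst// subrr mulr0 addr0.
rewrite (eq_bigr (fun s => expR (- c) * (p s * expR (l * (f s - m))))); last first.
  by move=> s _; rewrite expRD; ring.
rewrite -mulr_sumr; apply: le_trans (ler_wpM2l (expR_ge0 _) le1) _.
by rewrite -expRD ler_expR /c; lra.
Qed.

Definition ffun_upd (I : finType) (T : Type) (w : {ffun I -> T}) (i0 : I) (y : T) :
  {ffun I -> T} := [ffun i => if i == i0 then y else w i].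

(* Swapping the coordinate [i0] of [w] with an independent copy [y] preserves
   the product law. *)
Lemma product_resample_le (R : realType) (I T : finType) (q : I -> T -> R)
    (i0 : I) (bad : pred {ffun I -> T}) (d : R) :
  (forall i, is_dist (q i)) ->
  (forall w, \sum_(y | bad (ffun_upd w i0 y)) q i0 y <= d) ->
  \sum_(w : {ffun I -> T} | bad w) \prod_i q i (w i) <= d.
Proof.
move=> qd bd; pose W (w : {ffun I -> T}) := \prod_i q i (w i).
have W0 w : 0 <= W w by apply: prodr_ge0 => i _; have [] := qd i.
have WE w y : W (ffun_upd w i0 y) * q i0 (w i0) = W w * q i0 y.
  rewrite /W (bigD1 i0)//= [X in _ = X * _](bigD1 i0)//= ffunE eqxx.
  rewrite (eq_bigr (fun i => q i (w i))); first by ring.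
  by move=> i /negbTE ii0; rewrite ffunE ii0.
have -> : \sum_(w | bad w) \prod_i q i (w i) =
    \sum_w W w * \sum_(y | bad (ffun_upd w i0 y)) q i0 y.
  transitivity (\sum_(u : {ffun I -> T} * T) W u.1 * q i0 u.2 * (bad u.1)%:R).
    rewrite -(pair_bigA _ (fun w y => W w * q i0 y * (bad w)%:R)) /=.
    rewrite big_mkcond; apply: eq_bigr => w _.
    rewrite -mulr_suml -mulr_sumr; have [_ ->] := qd i0.
    by rewrite mulr1; case: (bad w); rewrite ?mulr1 ?mulr0.
  pose phi (u : {ffun I -> T} * T) := (ffun_upd u.1 i0 u.2, u.1 i0).
  have phiK : involutive phi.
    move=> [w y]; rewrite /phi /= ffunE eqxx; congr (_, _).
    by apply/ffunP => i; rewrite !ffunE; case: eqP => [->|].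
  rewrite (reindex_inj (inv_inj phiK)) /=.
  under eq_bigr do rewrite WE.
  rewrite -(pair_bigA _ (fun w y => W w * q i0 y * (bad (ffun_upd w i0 y))%:R)) /=.
  apply: eq_bigr => w _; rewrite mulr_sumr [RHS]big_mkcond; apply: eq_bigr => y _.
  by case: ifP; rewrite ?mulr1 ?mulr0.
apply: le_trans (_ : \sum_w W w * d <= d).
  by apply: ler_sum => w _; rewrite ler_wpM2l.
rewrite -mulr_suml -(bigA_distr_bigA q) big1 ?mul1r// => i _.
by have [] := qd i.
Qed.

(** The discounted optimality equation, stated as two inequalities instead of a maximum over
    actions. *)
Definition bellman_value (R : realType) (S A : finType) (M : mdp R S A) (g : R)
    (V : S -> R) : Prop :=
  (forall s a, reward M s a + g * mean (trans M s a) V <= V s) /\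
  (forall s, exists a, V s <= reward M s a + g * mean (trans M s a) V).

(* If the row [p'] gave [V] a smaller mean than [p], then [V] would also be a
   supersolution for the model with [p'], whose value at the row would then be
   smaller too. *)
Lemma bellman_row_monotone (R : realType) (S A : finType) (M M' : mdp R S A)
    (g : R) (V V' : S -> R) s0 a0 :
  (forall s a, is_dist (trans M s a)) -> (forall s a, is_dist (trans M' s a)) ->
  0 < g < 1 -> reward M = reward M' ->
  (forall s a, (s, a) != (s0, a0) -> trans M s a = trans M' s a) ->
  bellman_value M g V -> bellman_value M' g V' ->
  mean (trans M s0 a0) V <= mean (trans M' s0 a0) V' ->
  mean (trans M s0 a0) V <= mean (trans M' s0 a0) V.
Proof.
move=> Pd Pd' /andP[g0 g1] rr' PP' [Vsup _] [_ /choice[act V'act]] VV'.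
rewrite leNgt; apply/negP => lt.
have Vsup' s a : reward M' s a + g * mean (trans M' s a) V <= V s.
  apply: le_trans (Vsup s a); rewrite rr' lerD2l; apply: ler_wpM2l; first exact: ltW.
  have [[-> ->]|ne] := eqVneq (s, a) (s0, a0); first exact: ltW.
  by rewrite PP'.
have V'V s : V' s <= V s.
  rewrite -subr_le0.
  apply: (@maximum_principle _ _ (fun s => trans M' s (act s)) g
    (fun s => V' s - V s)) => //; first by rewrite ltW.
  move=> t; rewrite /kop meanB mulrBr.
  by have := V'act t; have := Vsup' t (act t); lra.
have : mean (trans M' s0 a0) V' <= mean (trans M' s0 a0) V by exact: ler_mean.
lra.
Qed.

Lemma perturbed_empirical_mean (R : realType) (S A : finType) (M : mdp R S A) N
    (x : S -> A -> 'I_N -> S) (z : S -> A -> R) s a f :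
  mean (trans (perturbed_empirical M x z) s a) f = sample_mean (x s a) f.
Proof.
rewrite /mean /sample_mean /= mulr_suml.
transitivity (\sum_t \sum_(i | x s a i == t) f (x s a i) / N%:R).
  apply: eq_bigr => t _; rewrite (eq_bigr (fun=> f t / N%:R)); last by move=> i /eqP ->.
  by rewrite sumr_const -[RHS]mulr_natl mulrA mulrAC.
rewrite (exchange_big_dep predT) //=; apply: eq_bigr => i _.
by rewrite (big_pred1 (x s a i))// => t; rewrite eq_sym.
Qed.

Lemma perturbed_empirical_dist (R : realType) (S A : finType) (M : mdp R S A) N
    (x : S -> A -> 'I_N -> S) (z : S -> A -> R) :
  (0 < N)%N -> forall s a, is_dist (trans (perturbed_empirical M x z) s a).
Proof.
move=> N0 s a; split=> [t|]; first by rewrite divr_ge0.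
have := perturbed_empirical_mean M x z s a (fun=> 1).
rewrite /mean; under eq_bigr do rewrite mulr1.
by move=> ->; rewrite /sample_mean sumr_const card_ord divff// pnatr_eq0 -lt0n.
Qed.

(* [V xs] depends on the row [(s0, a0)] of the samples. Among the rows that
   violate the bound take one, [y0], minimising the mean of its own value: by
   [bellman_row_monotone] every other violating row also violates the bound for
   the single function [V] attached to [y0], to which Bernstein applies. *)
Lemma value_concentration (R : realType) (S A : finType) (M : mdp R S A) N
    (z : S -> A -> R) (g l b B : R)
    (V : {ffun S * A -> {ffun 'I_N -> S}} -> S -> R) s0 a0 :
  (forall s a, is_dist (trans M s a)) -> (0 < N)%N -> 0 < g < 1 ->
  (forall xs : {ffun S * A -> {ffun 'I_N -> S}}, bellman_value
     (perturbed_empirical M (fun s a k => xs (s, a) k) z) g (V xs)) ->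
  (forall xs s, 0 <= V xs s <= B) -> 0 <= l -> l * B <= 1 / 3 ->
  \sum_(xs : {ffun S * A -> {ffun 'I_N -> S}} |
      mean (trans M s0 a0) (V xs) + l * dvariance (trans M s0 a0) (V xs) + b <
      sample_mean (xs (s0, a0)) (V xs))
    \prod_i iid_prob (trans M i.1 i.2) (xs i)
  <= expR (- (N%:R * l * b)).
Proof.
move=> Pd N0 g01 Vb VB l0 lB.
pose bad (xs : {ffun S * A -> {ffun 'I_N -> S}}) :=
  mean (trans M s0 a0) (V xs) + l * dvariance (trans M s0 a0) (V xs) + b <
  sample_mean (xs (s0, a0)) (V xs).
pose q (i : S * A) := @iid_prob _ _ (trans M i.1 i.2) N.
apply: (@product_resample_le _ _ _ q (s0, a0) bad).
  by move=> i; split=> [y|]; [exact: iid_prob_ge0|exact: sum_iid_prob].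
move=> w; pose upd y := ffun_upd w (s0, a0) y.
have updE y : upd y (s0, a0) = y by rewrite ffunE eqxx.
have [y1 bad1|none] := pickP (fun y => bad (upd y)); last first.
  by rewrite big_pred0 ?expR_ge0.
pose own (y : {ffun 'I_N -> S}) := sample_mean y (V (upd y)).
pose y0 := [arg min_(y < y1 | bad (upd y)) own y]%O.
have [bad0 min0] : bad (upd y0) /\ forall y, bad (upd y) -> own y0 <= own y.
  by rewrite /y0; case: arg_minP.
apply: le_trans (@bernstein_linear _ _ (trans M s0 a0) (V (upd y0)) N l b _ _ _ _) => //.
  rewrite big_mkcond [leRHS]big_mkcond; apply: ler_sum => y _.
  case: ifP => [bady|_]; last by case: ifP => // _; exact: iid_prob_ge0.
  rewrite ifT ?lexx//.
  move: bad0; rewrite /bad updE => /lt_le_trans; apply.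
  pose Mh y := perturbed_empirical M (fun s a k => upd y (s, a) k) z.
  have := @bellman_row_monotone _ _ _ (Mh y0) (Mh y) g (V (upd y0)) (V (upd y)) s0 a0.
  rewrite !perturbed_empirical_mean !updE; apply=> //; rewrite ?updE.
  - exact: perturbed_empirical_dist.
  - exact: perturbed_empirical_dist.
  - move=> s a ne; apply/funext => t /=; congr (_ / _); congr (_%:R).
    by apply: eq_card => k; rewrite !inE !ffunE (negbTE ne).
  - exact: Vb.
  - exact: Vb.
  - exact: min0.
move=> s; apply: le_trans lB; apply: ler_wpM2l => //.
have /andP[_ Vs] := VB (upd y0) s.
have : 0 <= mean (trans M s0 a0) (V (upd y0)).
  by apply: mean_ge_cst => // t; have /andP[] := VB (upd y0) t.
lra.
Qed.

(** * Discretisation of the noise *)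

Lemma measure_finite_partition (R : realType) (d : measure_display)
    (Omega : measurableType d) (Pr : probability Omega R) (T : finType)
    (F : T -> set Omega) (good : pred T) :
  (forall t, measurable (F t)) -> trivIset setT F ->
  measurable (\bigcup_(t in [set t | good t]) F t) /\
  Pr (\bigcup_(t in [set t | good t]) F t) = (\sum_(t | good t) Pr (F t))%E.
Proof.
move=> mF tF; have fin : finite_set [set t | good t] by exact: finite_finset.
split; first exact: fin_bigcup_measurable.
rewrite measure_fin_bigcup//; last exact: sub_trivIset tF.
have -> : [set t | good t] = [set` [seq t <- index_enum T | good t]].
  by apply/seteqP; split=> t /=; rewrite mem_filter mem_index_enum andbT.
by rewrite -fsbig_seq ?filter_uniq ?index_enum_uniq// big_filter.
Qed.

(** Half-open, so that a perturbation lies in at most one cell. *)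
Definition box (R : realType) (m : R) (k : nat) : set R :=
  [set` `[k%:R * m, k.+1%:R * m[].

Lemma box_inj (R : realType) (m z : R) (j k : nat) :
  0 < m -> box m j z -> box m k z -> j = k.
Proof.
move=> m0; rewrite /box /= !in_itv /= -!ler_pdivlMr// -!ltr_pdivrMr//.
by move=> /truncn_def <- /truncn_def.
Qed.

Lemma box_cover (R : realType) (m z : R) :
  0 < m -> 0 <= z -> box m (Num.truncn (z / m)) z.
Proof.
move=> m0 z0; rewrite /box /= in_itv /= -ler_pdivlMr// -ltr_pdivrMr//.
by apply: truncn_itv; rewrite divr_ge0// ltW.
Qed.

(** [F t] is the event that the samples equal [t.1] and each perturbation lies in the cell numbered
    by [t.2]; independence turns its probability into a product. The lower end of the cell serves as
    rounded perturbation. *)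
Lemma noise_discretization (R : realType) (S A : finType) (M : mdp R S A)
    (N : nat) (xi m : R) (d : measure_display) (Omega : measurableType d)
    (Pr : probability Omega R)
    (X : S -> A -> 'I_N -> Omega -> S) (zeta : S -> A -> Omega -> R) :
  0 < xi -> 0 < m -> algorithm_noise M xi Pr X zeta ->
  exists (K : nat) (p : S * A -> 'I_K.+1 -> R)
    (F : {ffun S * A -> {ffun 'I_N -> S}} * {ffun S * A -> 'I_K.+1} -> set Omega),
  [/\ K%:R * m <= xi, forall i, is_dist (p i), trivIset setT F,
      forall t, measurable (F t) /\
        Pr (F t) = ((\prod_i iid_prob (trans M i.1 i.2) (t.1 i)) *
                    \prod_i p i (t.2 i))%:E
    & forall t w, F t w ->
        (forall s a k, X s a k w = t.1 (s, a) k) /\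
        (forall s a, (t.2 (s, a))%:R * m <= zeta s a w <= (t.2 (s, a))%:R * m + m)].
Proof.
move=> xi0 m0 [mX lX mz lz ind].
(* The last cell starts at or below [xi] and ends beyond it: rounded perturbations never exceed
   [xi], and the cells cover the support of the uniform law. *)
pose K := Num.truncn (xi / m).
have /andP[Kxi xiK] : K%:R <= xi / m < K.+1%:R by rewrite truncn_itv// divr_ge0// ltW.
rewrite ler_pdivlMr// in Kxi; rewrite ltr_pdivrMr// in xiK.
pose Z (i : S * A) (k : nat) := zeta i.1 i.2 @^-1` box m k.
have mZ i k : measurable (Z i k).
  by rewrite -[Z _ _]setTI; apply: mz => //; exact: measurable_itv.
pose p i (k : 'I_K.+1) := fine (Pr (Z i k)).
have pE i (k : 'I_K.+1) : Pr (Z i k) = (p i k)%:E by rewrite fineK// fin_num_measure.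
have pd i : is_dist (p i).
  split=> [k|]; first exact: fine_ge0.
  apply: EFin_inj; rewrite -sumEFin; under eq_bigr do rewrite -pE.
  have tZ : trivIset setT (fun k : 'I_K.+1 => Z i k).
    by move=> j k _ _ [w [jw kw]]; apply: val_inj; exact: box_inj m0 jw kw.
  have [_ <-] := measure_finite_partition Pr xpredT (fun k : 'I_K.+1 => mZ i k) tZ.
  have -> : \bigcup_(k in [set k : 'I_K.+1 | xpredT k]) Z i k =
      zeta i.1 i.2 @^-1` `[0, K.+1%:R * m[%classic.
    apply/seteqP; split=> w /=.
      move=> [k _]; rewrite /Z /box /= !in_itv /= => /andP[kz zk].
      apply/andP; split; first by apply: le_trans kz; rewrite mulr_ge0// ltW.
      by apply: lt_le_trans zk _; rewrite ler_pM2r// ler_nat.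
    rewrite in_itv /= => /andP[z0 zK].
    have kK : (Num.truncn (zeta i.1 i.2 w / m) < K.+1)%N.
      rewrite -(ltr_nat R) -(ltr_pM2r m0); apply: le_lt_trans zK.
      by have := box_cover m0 z0; rewrite /box /= in_itv /= => /andP[].
    by exists (Ordinal kK) => //; exact: box_cover.
  rewrite lz; last exact: measurable_itv.
  apply: integral_uniform_pdf1 => // z /=; rewrite !in_itv /= => /andP[-> zx] /=.
  exact: le_lt_trans xiK.
exists K, p.
pose D (t : {ffun S * A -> {ffun 'I_N -> S}} * {ffun S * A -> 'I_K.+1})
    (i : (S * A * 'I_N) + (S * A)) : set Omega :=
  match i with
  | inl (s, a, k) => X s a k @^-1` [set t.1 (s, a) k]
  | inr i => Z i (t.2 i)
  end.
have mD t i : measurable (D t i) by case: i => [[[s a] k]|i]; [exact: mX|exact: mZ].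
exists (fun t => \bigcap_(i in [set i | i \in [set: (S * A * 'I_N) + (S * A)]%SET]) D t i).
split=> //.
- move=> t u _ _ [w [tw uw]].
  rewrite (surjective_pairing t) (surjective_pairing u).
  congr (_, _); apply/ffunP => -[s a].
    apply/ffunP => k; have := tw (inl (s, a, k)); have := uw (inl (s, a, k)).
    by rewrite /= inE => /(_ isT) <- /(_ isT).
  apply: val_inj; have := tw (inr (s, a)); have := uw (inr (s, a)).
  by rewrite /= inE => /(_ isT) uz /(_ isT) tz; exact: box_inj m0 tz uz.
- move=> t; split.
    by apply: fin_bigcap_measurable => //; exact: finite_finset.
  rewrite ind; last first.
    move=> [[[s a] k]|[s a]] _ /=; first by exists [set t.1 (s, a) k] => //; rewrite setTI.
    by exists (box m (t.2 (s, a))); [exact: measurable_itv|rewrite setTI].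
  rewrite big_sumType /= EFinM; congr (_ * _)%E.
    transitivity (\prod_(i : S * A) \prod_(k < N) Pr (D t (inl (i, k))))%E.
      by rewrite pair_bigA; apply: eq_big => [i|[[s a] k] _]; rewrite ?inE.
    rewrite -prodEFin; apply: eq_bigr => -[s a] _ /=.
    by rewrite /iid_prob -prodEFin; apply: eq_bigr => k _; exact: lX.
  by rewrite -prodEFin; apply: eq_big => [i|i _]; [rewrite inE|exact: pE].
- move=> t w tw; split=> [s a k|s a].
    by have := tw (inl (s, a, k)); rewrite /= inE; exact.
  have := tw (inr (s, a)); rewrite /= inE => /(_ isT).
  rewrite /Z /box /= in_itv /= -natr1 mulrDl mul1r => /andP[-> /ltW ->] //.
Qed.

(** * Union bound and elementary estimates *)

Lemma sum_exists_le (R : realType) (T I : finType) (Q : T -> R) (P : I -> pred T)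
    (e : R) :
  (forall t, 0 <= Q t) -> (forall i, \sum_(t | P i t) Q t <= e) ->
  \sum_(t | [exists i, P i t]) Q t <= #|I|%:R * e.
Proof.
move=> Q0 Pe; apply: (@le_trans _ _ (\sum_i \sum_(t | P i t) Q t)).
  under [leRHS]eq_bigr do rewrite big_mkcond.
  rewrite exchange_big big_mkcond; apply: ler_sum => t _ /=.
  have s0 i : 0 <= (if P i t then Q t else 0) by case: ifP.
  case: existsP => [[i Pit]|_]; last exact: sumr_ge0.
  by rewrite (bigD1 i)//= Pit lerDl sumr_ge0.
by apply: le_trans (ler_sum _ (fun i _ => Pe i)) _; rewrite sumr_const mulr_natl.
Qed.

Lemma sp_bounds (R : realType) (S : finType) (x : S -> R) s :
  0 <= x s - inf (range x) <= sp x.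
Proof.
have [c xc] := bounded_finType x.
have xs : range x (x s) by exists s.
rewrite subr_ge0 lerD2r; apply/andP; split.
  apply: ge_inf => //; exists (- c) => _ [t _ <-].
  by have := xc t; rewrite ler_norml => /andP[].
apply: ub_le_sup => //; exists c => _ [t _ <-].
by have := xc t; rewrite ler_norml => /andP[].
Qed.

(** Since [H >= 1], this provides two states, which keeps the logarithm in the sample size
    positive. *)
Lemma card_gt1_of_sp (R : realType) (S : finType) (x : S -> R) :
  0 < sp x -> (1 < #|S|)%N.
Proof.
rewrite ltnNge; apply: contraTN => /fintype_le1P S1; rewrite -leNgt /sp.
have [s _|noS] := pickP (@predT S).
  suff -> : range x = [set x s] by rewrite sup1 inf1 subrr.
  by apply/seteqP; split=> [_ [t _ <-]|_ ->]; [rewrite (S1 s t)|exists s].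
suff -> : range x = set0 by rewrite sup0 inf0 subrr.
by apply/seteqP; split=> // y [t]; have := noS t.
Qed.

(** Conditioning on the second component: a bound uniform in it survives averaging over [W2]. *)
Lemma sum_pair_le (R : realType) (T U : finType) (W1 : T -> R) (W2 : U -> R)
    (P : pred (T * U)) (e : R) :
  is_dist W2 -> (forall u, \sum_(t | P (t, u)) W1 t <= e) ->
  \sum_(p | P p) W1 p.1 * W2 p.2 <= e.
Proof.
move=> [W20 W21] Pe; rewrite big_mkcond /=.
rewrite (eq_bigr (fun p => if P (p.1, p.2) then W1 p.1 * W2 p.2 else 0)); last by case.
rewrite -(pair_bigA _ (fun t u => if P (t, u) then W1 t * W2 u else 0)) /=.
rewrite exchange_big /= -[leRHS]mul1r -W21 mulr_suml; apply: ler_sum => u _.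
apply: le_trans (ler_wpM2l (W20 u) (Pe u)).
rewrite mulr_sumr [leRHS]big_mkcond; apply: ler_sum => t _.
by case: ifP => //; rewrite mulrC.
Qed.

(** With [y = n / (eps * delta) >= n / delta] the left side is at most [y ^ -2 <= (delta / n) ^ 2],
    and one factor [delta / n] is at most 1/2. A union over [2 * n] events then costs [delta]. *)
Lemma tail_bound (R : realType) (n eps delta q : R) :
  2 <= n -> 0 < eps <= 1 -> 0 < delta <= 1 ->
  2 * ln (n / (eps * delta)) <= q -> expR (- q) <= delta / (2 * n).
Proof.
move=> n2 /andP[e0 e1] /andP[d0 d1] nq.
have n0 : 0 < n by lra.
set y := n / (eps * delta) in nq *.
have y0 : 0 < y by rewrite divr_gt0// mulr_gt0.
have ny : n / delta <= y.
  rewrite /y ler_pM2l// lef_pV2 ?posrE ?mulr_gt0//.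
  by rewrite -[leRHS]mul1r ler_wpM2r// ltW.
clearbody y; apply: (@le_trans _ _ (y^-1 ^+ 2)).
  rewrite -[y in leRHS]lnK ?posrE// -expRN -expRM_natl ler_expR.
  by rewrite mulrN lerN2.
have yn : y^-1 <= delta / n.
  by rewrite -[leRHS]invrK invf_div lef_pV2 ?posrE ?divr_gt0.
have dn1 : delta / n <= 1 / 2 by rewrite ler_pdivrMr//; lra.
apply: (@le_trans _ _ (delta / n * (1 / 2))).
  by rewrite expr2 ler_pM ?invr_ge0 ?(ltW y0)//; exact: le_trans dn1.
by rewrite le_eqVlt; apply/orP; left; apply/eqP; field; rewrite gt_eqF.
Qed.

(** * From concentration to the gain of the output policy *)

Lemma gain_ge0 (R : realType) (S A : finType) (M : mdp R S A)
    (pi : policy R S A) s :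
  is_mdp M -> is_policy pi -> 0 <= gain M pi s.
Proof.
move=> [Pd r01] pid; apply: (@gain_ge _ _ _ _ _ _ (fun=> 0)) => // t.
rewrite /kop mean_cst ?addr0; last exact: pol_kernel_dist.
by apply: mean_ge_cst => // a; have /andP[] := r01 t a.
Qed.

(* Per-step errors: [eps / 10 + eps / 10 + eps / 6] for the lower bound on the
   empirical value, and [eps / 10 + eps / 10 + 2 * (eps / 12 + eps / 20)] for
   the gain. *)
Lemma reduction_gain (R : realType) (S A : finType) (M : mdp R S A)
    (pistar pihat : policy R S A) (H eps rho xi : R) (N : nat)
    (x : S -> A -> 'I_N -> S) (z zeta : S -> A -> R) (h V : S -> R) :
  let g := red_gamma H eps in
  let m := eps / 20 * (1 - g) in
  let f s := h s + 9 * (eps / (180 * H)) * h s ^+ 2 in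
  let B := 2 / (1 - g) in
  is_mdp M -> is_policy pistar -> (0 < N)%N -> 1 <= H -> 0 < eps <= 1 ->
  0 <= rho -> (forall s, 0 <= h s <= H) ->
  (forall s, pol_reward M pistar s = rho + h s - kop (pol_kernel M pistar) h s) ->
  xi <= eps / 12 ->
  (forall s a, 0 <= z s a <= xi) ->
  (forall s a, z s a <= zeta s a <= z s a + m) ->
  bellman_value (perturbed_empirical M x z) g V ->
  (forall s, 0 <= V s <= B) ->
  (forall s a, mean (trans M s a) f - eps / (180 * H) * dvariance (trans M s a) f
     - eps / 10 <= sample_mean (x s a) f) ->
  (forall s a, sample_mean (x s a) V <= mean (trans M s a) V +
     eps / (80 * B) * dvariance (trans M s a) V + eps / 20) ->
  disc_optimal (perturbed_empirical M x zeta) g pihat ->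
  forall s, rho - eps <= gain M pihat s.
Proof.
move=> g m f B Mm pid N0 H1 /andP[e0 e1] rho0 hH rh xie zxi zm.
move=> [Vsup Vatt] VB fconc Vconc opt s.
have [Pd r01] := Mm; have [pihatd _] := opt.
have H0 : 0 < H by lra.
have gE : 1 - g = eps / (12 * H) by rewrite /g /red_gamma opprB addrC subrK.
have g1 : 0 < 1 - g by rewrite gE divr_gt0// mulr_gt0.
have eH : eps / (12 * H) <= 1 / 12.
  by rewrite ler_pdivrMr ?mulr_gt0//; have := mulr_gt0 e0 H0; lra.
have g01 : 0 <= g < 1 by apply/andP; split; lra.
have Pd' : forall s a, is_dist (trans (perturbed_empirical M x z) s a).
  exact: perturbed_empirical_dist.
have B0 : 0 < B by rewrite divr_gt0.
set l1 := eps / (180 * H) in f fconc *; set l2 := eps / (80 * B) in Vconc *.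
have l1H : l1 * H = eps / 180 by rewrite /l1; field; lra.
have l2B : l2 * B = eps / 80 by rewrite /l2; field; lra.
have l10 : 0 <= l1 by rewrite ltW// divr_gt0// mulr_gt0.
have l20 : 0 <= l2 by rewrite ltW// divr_gt0// mulr_gt0.
have gH : (1 - g) * H = eps / 12 by rewrite gE; field; lra.
have m0 : 0 <= m by rewrite ltW// mulr_gt0// divr_gt0.
have mg : m / (1 - g) = eps / 20 by rewrite /m mulfK// gt_eqF.
have m1 : m <= 1.
  have : eps / 20 * (1 - g) <= eps / 20 * 1 by rewrite ler_wpM2l; lra.
  rewrite /m; lra.
pose g0 := rho - (18 * l1 * H + eps / 10) - 2 * (1 - g) * H.
have g0E : g0 = rho - (eps / 10 + eps / 10) - eps / 6.
  by rewrite /g0 -(mulrA 18) l1H -(mulrA 2) gH; field.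
have gV u : g0 <= (1 - g) * V u.
  apply: (@value_lower_bound _ _ _ M (perturbed_empirical M x z) pistar rho H g l1
    (eps / 10) h V) => //.
  - by move=> t a; have /andP[] := r01 t a.
  - by move=> t a /=; rewrite lerDl; have /andP[] := zxi t a.
  - by rewrite -(mulrA 9) l1H; lra.
  - by move=> f' t a; rewrite perturbed_empirical_mean; exact: fconc.
have Vpi u : V u <= pol_reward M pihat u + (xi + m / (1 - g)) +
    g * kop (pol_kernel (perturbed_empirical M x z) pihat) V u.
  have near : V u <= pol_reward (perturbed_empirical M x z) pihat u + m / (1 - g) +
      g * kop (pol_kernel (perturbed_empirical M x z) pihat) V u.
    (* The reward bound 3 is crude: [1 + xi + m] with [xi <= eps / 12] and [m <= 1]. *)
    apply: (@disc_optimal_near_bellman _ _ _ (trans (perturbed_empirical M x z))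
      (reward (perturbed_empirical M x z)) (reward (perturbed_empirical M x zeta))
      g 3 m V pihat) => // t a /=.
      by have := r01 t a; have := zxi t a; have := zm t a; lra.
    by have := zm t a; lra.
  have : pol_reward (perturbed_empirical M x z) pihat u <= pol_reward M pihat u + xi.
    rewrite -[X in _ + X](mean_cst _ (pihatd u)) -meanD; apply: ler_mean => // a.
    by rewrite /= lerD2l; have /andP[] := zxi u a.
  lra.
have := @gain_lower_bound _ _ _ M (perturbed_empirical M x z) pihat g0 B g l2
  (eps / 20) (xi + m / (1 - g)) V Pd pihatd _ _ g01 VB l20 _ _ _ gV Vpi _ s.
(* Nonnegativity of [xi] is read off from some [z s a]; without actions there would be no policy at
   all. *)
have xi0 : 0 <= xi + m / (1 - g).
  apply: addr_ge0; last by rewrite mg; lra.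
  have [a _|noA] := pickP (@predT A); first by have := zxi s a; lra.
  have [_] := pid s; rewrite big_pred0; last by move=> a; have := noA a.
  by move/eqP; rewrite eq_sym oner_eq0.
move=> G; apply: le_trans (G _ _ _ _ _ _) => //.
- rewrite g0E mg -(mulrA 8) l2B; lra.
- by move=> t a; have /andP[] := r01 t a.
- rewrite g0E; lra.
- by rewrite -(mulrA 4) l2B; lra.
- lra.
- by move=> t a; rewrite perturbed_empirical_mean; exact: Vconc.
Qed.

(** The function [f] does not depend on the samples, so with the other rows fixed the linear
    Bernstein bound applies directly to [- f]. *)
Lemma row_concentration (R : realType) (S A : finType) (M : mdp R S A) N
    (l b C : R) (f : S -> R) (i0 : S * A) :
  (forall s a, is_dist (trans M s a)) -> (0 < N)%N -> 0 <= l ->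
  (forall s, 0 <= f s <= C) -> l * C <= 1 / 3 ->
  \sum_(xs : {ffun S * A -> {ffun 'I_N -> S}} |
      sample_mean (xs i0) f < mean (trans M i0.1 i0.2) f -
        l * dvariance (trans M i0.1 i0.2) f - b)
    \prod_i iid_prob (trans M i.1 i.2) (xs i)
  <= expR (- (N%:R * l * b)).
Proof.
move=> Pd N0 l0 fC lC; set p := trans M i0.1 i0.2.
apply: (@product_resample_le _ _ _ (fun i => iid_prob (trans M i.1 i.2) (N := N)) i0
  (fun xs => sample_mean (xs i0) f < mean p f - l * dvariance p f - b)).
  by move=> i; split=> [y|]; [exact: iid_prob_ge0|exact: sum_iid_prob].
move=> w; have bern := @bernstein_linear _ _ p (fun s => - f s) N l b (Pd _ _) N0 l0.
rewrite meanN dvarianceN in bern.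
apply: le_trans (bern _) => [|s]; last first.
  apply: le_trans lC; apply: ler_wpM2l => //; have /andP[f0 _] := fC s.
  have : mean p f <= C by apply: mean_le_cst => [|t]; [exact: Pd|case/andP: (fC t)].
  lra.
rewrite le_eqVlt; apply/orP; left; apply/eqP; apply: eq_bigl => y.
rewrite ffunE eqxx (_ : sample_mean y (fun s => - f s) = - sample_mean y f).
  by apply/idP/idP; lra.
by rewrite /sample_mean sumrN mulNr.
Qed.

(** The right-hand sides are the exponents [N * l * b] of the two concentration bounds, with
    [24 * H / eps] for the bound [2 / (1 - g)] on values. The second equals [q]; the first has one
    factor [eps] less and is larger. *)
Lemma sample_size_exponents (R : realType) (H eps x : R) :
  1 <= H -> 0 < eps <= 1 -> 0 <= x ->
  let q := x * eps ^+ 3 / (20 * (80 * 24) * H) in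
  q <= x * (eps / (180 * H)) * (eps / 10) /\
  q <= x * (eps / (80 * (24 * H / eps))) * (eps / 20).
Proof.
move=> H1 /andP[e0 e1] x0 q; have H0 : 0 < H by lra.
pose r := x * eps ^+ 2 / H.
have r0 : 0 <= r by rewrite divr_ge0 ?mulr_ge0 ?sqr_ge0// ltW.
have -> : q = r * (eps / (20 * (80 * 24))) by rewrite /q /r; field; lra.
have -> : x * (eps / (180 * H)) * (eps / 10) = r * (1 / 1800).
  by rewrite /r; field; lra.
have -> : x * (eps / (80 * (24 * H / eps))) * (eps / 20) =
    r * (eps / (20 * (80 * 24))) by rewrite /r; field; apply/andP; split; lra.
by split=> //; apply: ler_wpM2l => //; lra.
Qed.

(** Chooses a value for all discrete outcomes at once. Rounded perturbed rewards are at most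
    [1 + xi <= 2], whence the numerator 2. *)
Lemma discretized_values (R : realType) (S A : finType) (M : mdp R S A) N K
    (g m xi : R) (a0 : A) :
  is_mdp M -> (0 < N)%N -> 0 <= g < 1 -> 0 <= m -> K%:R * m <= xi -> xi <= 1 ->
  exists V : {ffun S * A -> {ffun 'I_N -> S}} * {ffun S * A -> 'I_K.+1} -> S -> R,
    forall t : {ffun S * A -> {ffun 'I_N -> S}} * {ffun S * A -> 'I_K.+1},
      bellman_value (perturbed_empirical M (fun s a k => t.1 (s, a) k)
                (fun s a => (t.2 (s, a))%:R * m)) g (V t) /\
              (forall s, 0 <= V t s <= 2 / (1 - g)).
Proof.
move=> [Pd r01] N0 g01 m0 Km xi1.
suff /choice[V VE] : forall t : {ffun S * A -> {ffun 'I_N -> S}} * {ffun S * A -> 'I_K.+1},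
    exists V, bellman_value (perturbed_empirical M (fun s a k => t.1 (s, a) k)
                (fun s a => (t.2 (s, a))%:R * m)) g V /\
              (forall s, 0 <= V s <= 2 / (1 - g)) by exists V.
move=> t.
have [|V [VB Vsup Vatt]] := @bellman_solution _ _ _ (perturbed_empirical M
    (fun s a k => t.1 (s, a) k) (fun s a => (t.2 (s, a))%:R * m)) g 2 a0
    (perturbed_empirical_dist _ _ _ N0) g01.
  move=> s a /=; have := r01 s a.
  have : 0 <= (t.2 (s, a))%:R * m <= K%:R * m.
    by rewrite mulr_ge0//= ler_wpM2r// ler_nat -ltnS.
  lra.
by exists V.
Qed.

Theorem theorem3 (R : realType) :
  exists cp c0 : R, 0 < cp /\ 0 < c0 /\
  forall (S A : finType) (M : mdp R S A) (pistar : policy R S A)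
    (H eps delta : R) (N : nat),
    is_mdp M ->
    weakly_communicating M ->
    gain_optimal M pistar ->
    H = sp (bias M pistar) ->
    1 <= H ->
    0 < eps <= 1 ->
    0 < delta <= 1 ->
    c0 * H * eps ^- 3 * ln (#|S|%:R * #|A|%:R / (eps * delta)) <= N%:R ->
  forall (d : measure_display) (Omega : measurableType d)
    (Pr : probability Omega R)
    (X : S -> A -> 'I_N -> Omega -> S) (zeta : S -> A -> Omega -> R)
    (pihat : Omega -> policy R S A),
    algorithm_noise M (red_xi S A cp H eps) Pr X zeta ->
    reduction_output M H eps X zeta pihat ->
    exists E : set Omega,
      [/\ measurable E,
          E `<=` [set w | forall s, opt_gain M s - eps <= gain M (pihat w) s]
        & ((1 - delta)%:E <= Pr E)%E].
Proof.
(* [cp = 1] makes [xi <= eps / 12]. The second constant is twice the denominator [20 * (80 * 24)] of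
   [sample_size_exponents], as [tail_bound] needs twice the logarithm. *)
exists 1, (40 * (80 * 24)); split; first exact: ltr01.
split; first by rewrite !mulr_gt0.
move=> S A M pistar H eps delta N Mm wc gopt HE H1 /andP[e0 e1] /andP[d0 d1] hN.
move=> d Omega Pr X zeta pihat noise red.
have [Pd r01] := Mm; have [pid gE] := gopt.
have H0 : 0 < H by lra.
have S1 : (1 < #|S|)%N by apply: (@card_gt1_of_sp _ _ (bias M pistar)); rewrite -HE.
have [s0 _] : exists s0 : S, s0 \in S by apply/card_gt0P; exact: ltnW.
have [a0 _|noA] := pickP (@predT A); last first.
  have [_] := pid s0; rewrite big_pred0; last by move=> a; have := noA a.
  by move/eqP; rewrite eq_sym oner_eq0.
have A0 : (0 < #|A|)%N by apply/card_gt0P; exists a0.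
pose n : R := #|S|%:R * #|A|%:R.
have n2 : 2 <= n.
  rewrite /n -natrM ler_nat -[2%N]muln1; exact: leq_mul.
pose y := n / (eps * delta).
have y2 : 2 <= y.
  rewrite ler_pdivlMr ?mulr_gt0//.
  have : eps * delta <= 1 by rewrite mulr_ile1// ltW.
  lra.
have lny : 0 < ln y by rewrite ln_gt0//; lra.
have e3 : 0 < eps ^+ 3 by rewrite exprn_gt0.
have hN' : 40 * (80 * 24) * H * ln y <= N%:R * eps ^+ 3.
  rewrite -ler_pdivrMr//; apply: le_trans hN.
  by rewrite -/n -/y mulrAC.
have N0 : (0 < N)%N.
  rewrite -(ltr_nat R); rewrite -(pmulr_lgt0 _ e3).
  by apply: lt_le_trans hN'; rewrite !mulr_gt0.
have N0' : 0 < N%:R :> R by rewrite ltr0n.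
pose g := red_gamma H eps.
have gE1 : 1 - g = eps / (12 * H) by rewrite /g /red_gamma opprB addrC subrK.
have g1 : 0 < 1 - g by rewrite gE1 divr_gt0// mulr_gt0.
have eH : eps / (12 * H) <= 1 / 12 by rewrite ler_pdivrMr ?mulr_gt0//; lra.
have g01 : 0 < g < 1 by apply/andP; split; lra.
(* The mesh is chosen so that rounding costs [m / (1 - g) = eps / 20] in value. *)
pose m := eps / 20 * (1 - g).
have m0 : 0 < m by rewrite mulr_gt0// divr_gt0.
pose B := 2 / (1 - g).
have BE : B = 24 * H / eps by rewrite /B gE1; field; apply/andP; split; lra.
have B0 : 0 < B by rewrite divr_gt0.
pose l1 := eps / (180 * H); pose l2 := eps / (80 * B).
have l10 : 0 <= l1 by rewrite ltW// divr_gt0// mulr_gt0.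
have l20 : 0 <= l2 by rewrite ltW// divr_gt0// mulr_gt0.
have l1H : l1 * H = eps / 180 by rewrite /l1; field; lra.
have l2B : l2 * B = eps / 80 by rewrite /l2; field; lra.
set xi := red_xi S A 1 H eps in noise.
have xiE : xi = eps / 12 / (#|S|%:R ^+ 5 * #|A|%:R ^+ 5).
  by rewrite /xi /red_xi /red_eps -/g mul1r; congr (_ / _); field; lra.
have D1 : 1 <= #|S|%:R ^+ 5 * #|A|%:R ^+ 5 :> R.
  by rewrite -!natrX -natrM ler1n muln_gt0 !expn_gt0 A0 (ltnW S1).
have xi0 : 0 < xi by rewrite xiE !divr_gt0// (lt_le_trans _ D1).
have xi12 : xi <= eps / 12.
  rewrite xiE ler_pdivrMr ?(lt_le_trans _ D1)//.
  by rewrite -[leLHS]mulr1 ler_wpM2l// ltW// divr_gt0.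
have [K [p [F [Kxi pd tF mF FE]]]] := noise_discretization xi0 m0 noise.
have [V VE] := @discretized_values _ _ _ M N K g m xi a0 Mm N0 (ltac:(lra))
  (ltW m0) Kxi (ltac:(lra)).
pose rho := opt_gain M s0.
have rhoE s : opt_gain M s = rho by exact: opt_gain_constant gopt _ _.
(* Shifting the bias to minimum 0 preserves the Poisson equation and puts [h] between 0 and [H]. *)
pose h s := bias M pistar s - inf (range (bias M pistar)).
have hH s : 0 <= h s <= H by rewrite HE; exact: sp_bounds.
have [Kk rb] := gain_bias_poisson Pd pid.
have rh s : pol_reward M pistar s = rho + h s - kop (pol_kernel M pistar) h s.
  rewrite rb gE rhoE /h /kop meanB mean_cst; last exact: pol_kernel_dist.
  by ring.
have rho0 : 0 <= rho by rewrite /rho -gE gain_ge0.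
pose f s := h s + 9 * l1 * h s ^+ 2.
have fH : forall s, 0 <= f s <= 2 * H.
  apply: quadratic_potential_bounds => //; first exact: mulr_ge0.
  by rewrite -(mulrA 9 l1 H) l1H; clear - e0 e1; lra.
pose W1 (xs : {ffun S * A -> {ffun 'I_N -> S}}) : R :=
  \prod_i iid_prob (trans M i.1 i.2) (xs i).
pose W2 (k : {ffun S * A -> 'I_K.+1}) : R := \prod_i p i (k i).
pose Q t := W1 t.1 * W2 t.2.
(* Two failures per row: the lower bound for the fixed potential [f], and the upper bound for the
   random value [V t]. *)
pose bad (q : (S * A) * bool)
    (t : {ffun S * A -> {ffun 'I_N -> S}} * {ffun S * A -> 'I_K.+1}) : bool :=
  let: (i, lower) := q in let P := trans M i.1 i.2 in
  if lower then sample_mean (t.1 i) f < mean P f - l1 * dvariance P f - eps / 10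
  else mean P (V t) + l2 * dvariance P (V t) + eps / 20 < sample_mean (t.1 i) (V t).
pose good t := ~~ [exists q, bad q t].
have W2d : is_dist W2.
  split=> [k|]; first by apply: prodr_ge0 => i _; case: (pd i).
  by rewrite /W2 -(bigA_distr_bigA p) big1// => i _; case: (pd i).
have Q0 t : 0 <= Q t.
  rewrite mulr_ge0//; first by apply: prodr_ge0 => i _; exact: iid_prob_ge0.
  by case: W2d => W0 _; exact: W0.
have tail q : N%:R * eps ^+ 3 / (20 * (80 * 24) * H) <= q -> expR (- q) <= delta / (2 * n).
  move=> hq; apply: (@tail_bound _ n eps delta) => //; rewrite ?e0 ?d0//.
  apply: le_trans hq; rewrite -/y ler_pdivlMr ?mulr_gt0//.
  by apply: le_trans hN'; rewrite le_eqVlt; apply/orP; left; apply/eqP; ring.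
have e01 : 0 < eps <= 1 by rewrite e0.
have [q1 q2] := sample_size_exponents H1 e01 (ler0n R N).
(* The lower failure does not involve the perturbation. For the upper one the cells [k] are frozen,
   so that the value depends on the samples alone. *)
have badle q : \sum_(t | bad q t) Q t <= delta / (2 * n).
  case: q => i [].
    apply: (@sum_pair_le _ _ _ W1 W2 (bad (i, true))) => // k.
    apply: le_trans (tail _ q1); apply: row_concentration fH _ => //.
    by rewrite mulrCA l1H; clear - e0 e1; lra.
  apply: (@sum_pair_le _ _ _ W1 W2 (bad (i, false))) => // k.
  rewrite -BE -/l2 in q2; apply: le_trans (tail _ q2); case: i => s a.
  apply: (@value_concentration _ _ _ M N (fun s a => (k (s, a))%:R * m) g l2
    (eps / 20) B (fun xs => V (xs, k)) s a) => //.
  - by move=> xs; have [] := VE (xs, k).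
  - by move=> xs; have [] := VE (xs, k).
  - by rewrite l2B; clear - e0 e1; lra.
have [mE PE] := measure_finite_partition Pr good (fun t => (mF t).1) tF.
exists (\bigcup_(t in [set t | good t]) F t); split=> //.
  move=> w [t /= gt Ft] s.
  have [Xt zt] := FE t w Ft.
  have notbad q : ~~ bad q t by apply: contra gt => bt; apply/existsP; exists q.
  have := red w; rewrite -/g.
  have -> : (fun s a k => X s a k w) = (fun s a k => t.1 (s, a) k).
    by apply/funext => u; apply/funext => a; apply/funext => k; exact: Xt.
  have [bV VB] := VE t.
  rewrite rhoE => opt; apply: (@reduction_gain _ _ _ M pistar (pihat w) H eps rho xi N
    (fun s a k => t.1 (s, a) k) (fun s a => (t.2 (s, a))%:R * m)
    (fun s a => zeta s a w) h (V t)) => //; rewrite ?e0//.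
  - move=> u a; apply/andP; split; first by rewrite mulr_ge0// ltW.
    by apply: le_trans Kxi; rewrite ler_pM2r// ler_nat -ltnS.
  - by move=> u a; have := notbad ((u, a), true); rewrite /bad /= -leNgt.
  - by move=> u a; have := notbad ((u, a), false); rewrite /bad /= -leNgt.
rewrite PE (eq_bigr (fun t => (Q t)%:E)); last by move=> t _; exact: (mF t).2.
rewrite sumEFin lee_fin.
have Q1 : \sum_t Q t = 1.
  rewrite -(pair_bigA _ (fun xs k => W1 xs * W2 k)) /=.
  have [_ W21] := W2d; under eq_bigr do rewrite -mulr_sumr W21 mulr1.
  rewrite /W1 -(bigA_distr_bigA (fun i => @iid_prob _ _ (trans M i.1 i.2) N)) big1// => i _.
  exact: sum_iid_prob.
have Qbad := sum_exists_le Q0 badle.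
rewrite (bigID good) /= in Q1.
(* There are [2 * n] failures of probability at most [delta / (2 * n)] each. *)
have nE : #|{: (S * A) * bool}|%:R * (delta / (2 * n)) = delta.
  rewrite !card_prod card_bool !natrM -/n; field.
  by rewrite gt_eqF// (lt_le_trans _ n2).
rewrite nE in Qbad.
rewrite lerBlDr -Q1 lerD2l; apply: le_trans Qbad.
by rewrite (eq_bigl (fun t => [exists q, bad q t])) // => t; rewrite negbK.
Qed.
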